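(* Let $H$ be the graph on vertex set $\{0,1,2,3\}$ with red edge set $\{\{0,1\},\{0,2\},\{1,2\},\{2,3\}\}$ and blue edge set $\{\{0,3\}\}$. Then $\lambda_H=12/125$, the semi-inducibility problem for $H$ is perfectly $K_5$-stable, and the unique maximizer of $\lambda_H(K_5(\mathbf a))$ over vectors $\mathbf a$ of five non-negative reals summing to $1$ is $\mathbf a=(1/5,1/5,1/5,1/5,1/5)$.
   Context: All graphs are finite and simple; the order of a graph is its number of vertices. For a graph $H$ with $\kappa$ vertices whose edges are coloured red or blue and an uncoloured graph $G$ of order $n\ge\kappa$, an embedding of $H$ into $G$ is an injection $V(H)\to V(G)$ that maps red edges of $H$ to edges of $G$ and blue edges of $H$ to non-edges of $G$ (pairs of distinct non-adjacent vertices). $\Lambda_H(G)$ is the number of embeddings, $\lambda_H(G):=\Lambda_H(G)/\big(n(n-1)\cdots(n-\kappa+1)\big)$, $\lambda_H(n)$ is the maximum of $\lambda_H(G)$ over all graphs $G$ of order $n$, and $\lambda_H:=\lim_{n\to\infty}\lambda_H(n)$ (the limit exists). For a graph $B$ on $\{0,\dots,m-1\}$ and pairwise disjoint finite sets $V_0,\dots,V_{m-1}$ (some possibly empty), the blowup $B(V_0,\dots,V_{m-1})$ is the graph on $\bigcup_i V_i$ in which $x\in V_i$ and $y\in V_j$ are adjacent if and only if $\{i,j\}\in E(B)$. For a vector $\mathbf a=(a_0,\dots,a_{m-1})$ of non-negative reals summing to $1$, $\lambda_H(B(\mathbf a))$ denotes the limit as $n\to\infty$ of $\lambda_H(B(V_0,\dots,V_{m-1}))$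 where $\sum_i|V_i|=n$ and $|V_i|=(a_i+o(1))n$. Equivalently, it is $\sum_f\prod_{i\in V(H)}a_{f(i)}$, the sum being over all maps $f:V(H)\to V(B)$ sending every red edge of $H$ to an edge of $B$ and every blue edge to a non-edge of $B$ or to two equal vertices. The edit distance $\delta_{\mathrm{edit}}(G,G')$ between two graphs of the same order is the minimum of $|f(E(G))\bigtriangleup E(G')|$ over all bijections $f:V(G)\to V(G')$. The semi-inducibility problem for $H$ is perfectly $B$-stable if there is $C>0$ such that for every graph $G$ of order $n\ge C$ there is a blowup $G'$ of $B$ of order $n$ with $\delta_{\mathrm{edit}}(G,G')\le C\,(\lambda_H(n)-\lambda_H(G))\,n^2$. (Here $C\ge\kappa$ may be assumed.) *)

(* Defs.v *)
From HB Require Import structures.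
From mathcomp Require Import all_boot all_order all_algebra all_fingroup.

Set Implicit Arguments.
Unset Strict Implicit.
Unset Printing Implicit Defensive.

Import Order.TTheory GRing.Theory Num.Theory.

Section Graphs.
Variable T : finType.

Record sgraph := SGraph {
  edges :> {set {set T}};
  edges_card2 : [forall e in edges, #|e| == 2]
}.

HB.instance Definition _ := [isSub for edges].
HB.instance Definition _ := [Finite of sgraph by <:].

Definition adj (G : sgraph) : rel T := fun x y => [set x; y] \in edges G.

Record cgraph := CGraph {
  red : sgraph;
  blue : sgraph;
  red_blue_disjoint : [disjoint edges red & edges blue]
}.

End Graphs.

Section CompleteGraph.
Variable m : nat.

Definition complete_edges : {set {set 'I_m}} := [set e : {set 'I_m} | #|e| == 2].

Fact complete_card2 : [forall e in complete_edges, #|e| == 2].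
Proof. by apply/forall_inP => e; rewrite inE. Qed.

Definition complete_graph : sgraph 'I_m := SGraph complete_card2.

End CompleteGraph.

Section Blowup.
Variables (m : nat) (B : sgraph 'I_m) (T : finType).

(* The disjoint, possibly empty parts V_i are the fibres of p : T -> 'I_m.
   Vertices of the same part are never adjacent, because [set i; i] is a
   singleton and edges have two elements. *)
Definition blowup_edges (p : {ffun T -> 'I_m}) : {set {set T}} :=
  [set e : {set T} |
    [exists x, exists y, (e == [set x; y]) && adj B (p x) (p y)]].

Fact blowup_card2 (p : {ffun T -> 'I_m}) :
  [forall e in blowup_edges p, #|e| == 2].
Proof.
apply/forall_inP => e; rewrite inE => /existsP[x /existsP[y /andP[/eqP -> pxy]]].
have := forall_inP (edges_card2 B) _ pxy.
by rewrite !cards2; case: (eqVneq x y) => // ->; rewrite eqxx.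
Qed.

Definition blowup (p : {ffun T -> 'I_m}) : sgraph T := SGraph (blowup_card2 p).

Definition is_blowup (G : sgraph T) : Prop := exists p, G = blowup p.

End Blowup.

Section EditDistance.
Variables (T : finType) (G G' : sgraph T).

Definition edit_cost (s : {perm T}) : nat :=
  let sG := [set s @: (e : {set T}) | e in edges G] in
  #|((sG :\: edges G') :|: (edges G' :\: sG))|.

Definition edit_dist : nat := edit_cost [arg min_(s < 1%g) edit_cost s].

End EditDistance.

Section Embeddings.
Variables (V : finType) (H : cgraph V).

Definition is_embedding (T : finType) (G : sgraph T) (f : {ffun V -> T}) : bool :=
  [&& injectiveb f,
      [forall u, forall v, adj (red H) u v ==> adj G (f u) (f v)]
    & [forall u, forall v, adj (blue H) u v ==> ~~ adj G (f u) (f v)]].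

Definition num_embeddings (T : finType) (G : sgraph T) : nat :=
  #|[set f | is_embedding G f]|.

End Embeddings.

Section PawWithBlueEdge.

Local Notation v k := (inord k : 'I_4).

Definition paw_red_edges : {set {set 'I_4}} :=
  [set [set v 0; v 1]; [set v 0; v 2]; [set v 1; v 2]; [set v 2; v 3]].
Definition paw_blue_edges : {set {set 'I_4}} := [set [set v 0; v 3]].

Fact paw_red_card2 : [forall e in paw_red_edges, #|e| == 2].
Proof.
apply/forall_inP => e; rewrite !inE -!orbA.
by case/or4P => /eqP ->; rewrite cards2 -val_eqE /= !inordK.
Qed.

Fact paw_blue_card2 : [forall e in paw_blue_edges, #|e| == 2].
Proof.
by apply/forall_inP => e; rewrite inE => /eqP ->; rewrite cards2 -val_eqE /= !inordK.
Qed.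

Fact paw_red_blue_disjoint : [disjoint paw_red_edges & paw_blue_edges].
Proof.
rewrite disjoint_sym disjoints1 !inE !negb_or -!andbA.
by apply/and4P; split; apply/eqP => /setP E;
  move: (E (v 0)) (E (v 3)); rewrite !inE -!val_eqE /= !inordK.
Qed.

Definition paw_blue : cgraph 'I_4 :=
  @CGraph _ (SGraph paw_red_card2) (SGraph paw_blue_card2) paw_red_blue_disjoint.

End PawWithBlueEdge.

(* Loaded only now: the notations for classical sets shadow those for {set T}. *)
From mathcomp Require Import all_classical all_reals all_analysis.

Import numFieldNormedType.Exports.

Local Open Scope classical_set_scope.
Local Open Scope ring_scope.

Section Semiinducibility.
Variables (R : realType) (V : finType) (H : cgraph V).

Definition density (T : finType) (G : sgraph T) : R :=
  (num_embeddings H G)%:R / (#|T| ^_ #|V|)%:R.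

(* Densities are nonnegative, so the default 0 does not affect the maximum. *)
Definition max_density (n : nat) : R :=
  \big[Num.max/0]_(G : sgraph 'I_n) density G.

Definition perfectly_stable (m : nat) (B : sgraph 'I_m) : Prop :=
  exists C : R, 0 < C /\
    forall (T : finType) (G : sgraph T), C <= #|T|%:R ->
      exists G' : sgraph T, is_blowup B G' /\
        (edit_dist G G')%:R <= C * (max_density #|T| - density G) * #|T|%:R ^+ 2.

Section BlowupDensity.
Variables (m : nat) (B : sgraph 'I_m).

Definition part_sizes_cvg (a : 'rV[R]_m) (p : forall n, {ffun 'I_n -> 'I_m}) :=
  forall i, (#|p n @^-1: [set i]%SET|%:R / n%:R : R) @[n --> \oo] --> a 0 i.

(* The common limit of the densities of all sequences of blowups whose part
   sizes are (a_i + o(1)) n. *)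
Definition blowup_density (a : 'rV[R]_m) : R :=
  get [set l : R | forall p, part_sizes_cvg a p ->
    density (blowup B (p n)) @[n --> \oo] --> l].

Definition simplex : set 'rV[R]_m :=
  [set a | (forall i, 0 <= a 0 i) /\ \sum_i a 0 i = 1].

Definition is_maximizer (a : 'rV[R]_m) : Prop :=
  simplex a /\ forall b, simplex b -> blowup_density b <= blowup_density a.

End BlowupDensity.
End Semiinducibility.

(* Main.v *)
Require Import Defs.
From mathcomp Require Import all_boot all_order all_algebra all_fingroup.
From mathcomp Require Import ring lra zify.

Set Implicit Arguments.
Unset Strict Implicit.
Unset Printing Implicit Defensive.

Import Order.TTheory GRing.Theory Num.Theory.

Local Open Scope ring_scope.

(** Replacing one of two non-adjacent vertices x, y by a clone of the other changes
    the number [homs] of homomorphic copies of the paw (the vertices 0 and 3 may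
    coincide) convexly, so one of the two replacements does not decrease it, and
    repeating this ends in a complete multipartite graph.  There [homs] is n^4 times
    a polynomial in the part weights w whose value is 12/125 exactly for five equal
    parts: bound the only negative quadratic term - (sum w^2)^2 by a tangent and use
    a Lagrange multiplier, distinguishing whether some part is at least 1/2, at most
    four parts are at least 1/25, or at least five are.

    Stability is first local.  Let A be nearly extremal and differ in few pairs from
    the blowup of K_5 along an optimal partition p, which is then nearly balanced.
    If some vertex has many wrong pairs, correcting it gains order n^3, because the
    count of copies through a vertex is multiaffine in the five densities of its
    neighbourhood.  Otherwise expand [homs] around the blowup: the linear term of a
    wrong pair is at most - (3/25) n^2, or - (4/25) n^2 inside a part, and the higher
    terms are negligible.  Hence the blowup gains order n^2 per wrong pair.  Running
    the symmetrisation backwards, every step changes only 2n pairs, so the local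
    result forces all graphs on the way, and in the end A itself, to stay close to a
    blowup. *)

(** * Cloning a vertex: expansion of four-fold sums *)

Section Symmetrisation.
Variable T : finType.
Implicit Types (A : rel T) (x y : T).

Definition paw A (a b c d : T) : bool :=
  [&& A a b, A a c, A b c, A c d & ~~ A a d].

Definition homs A : nat := (\sum_a \sum_b \sum_c \sum_d paw A a b c d)%N.

(** The sum of the squared degrees; it breaks ties between graphs with equal [homs]. *)
Definition cherries A : nat := (\sum_a \sum_b \sum_c (A a b && A a c))%N.

Definition redirect x y (u : T) : T := if u == y then x else u.

(** Here [y] becomes a clone of [x]; pairs avoiding [y] keep their status. *)
Definition merge A x y : rel T := fun u v => A (redirect x y u) (redirect x y v).

Lemma merge_sym A x y : symmetric A -> symmetric (merge A x y).
Proof. by move=> symA u v; apply: symA. Qed.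

Lemma merge_irr A x y : irreflexive A -> irreflexive (merge A x y).
Proof. by move=> irrA u; apply: irrA. Qed.

Section Convexity.
Variables (R : realFieldType) (x y : T).

Let D (g : T -> R) : R := g x - g y.

Lemma sum_redirect (g : T -> R) :
  \sum_u g (redirect x y u) = \sum_u g u + D g.
Proof.
rewrite (bigD1 y) //= [in RHS](bigD1 y) //= /redirect eqxx /D.
rewrite (eq_bigr g) => [|u /negPf ->//]; ring.
Qed.

Lemma sum_redirect_opp (g : T -> R) :
  \sum_u g (redirect y x u) = \sum_u g u - D g.
Proof.
rewrite (bigD1 x) //= [in RHS](bigD1 x) //= /redirect eqxx /D.
rewrite (eq_bigr g) => [|u /negPf ->//]; ring.
Qed.

Lemma sum2_redirect (g : T -> T -> R) (s : R) (f : T -> T) :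
  (forall h, \sum_u h (f u) = \sum_u h u + s * D h) ->
  \sum_u \sum_v g (f u) (f v) =
    \sum_u \sum_v g u v + s * \sum_u D (g u) + s * \sum_v D (g^~ v)
    + s ^+ 2 * D (fun u => D (g u)).
Proof.
move=> fE; rewrite (fE (fun u => \sum_v g u (f v))) /D.
under eq_bigr do rewrite fE.
rewrite !fE big_split /= -mulr_sumr !sumrB /D; ring.
Qed.

(** Redirecting one argument adds [s * D], with [s = 1] when [y] goes to [x] and [s = -1] in the
    opposite case. In the sum of both expansions the odd orders cancel, which leaves the six
    second-order terms and the fourth-order one. *)
Lemma sum4_redirect (g : T -> T -> T -> T -> R) :
  \sum_a \sum_b \sum_c \sum_d
     g (redirect x y a) (redirect x y b) (redirect x y c) (redirect x y d)
  + \sum_a \sum_b \sum_c \sum_d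
     g (redirect y x a) (redirect y x b) (redirect y x c) (redirect y x d)
  = 2 * (\sum_a \sum_b \sum_c \sum_d g a b c d
     + \sum_a \sum_b D (fun c => D (fun d => g a b c d))
     + \sum_a \sum_c D (fun b => D (fun d => g a b c d))
     + \sum_a \sum_d D (fun b => D (fun c => g a b c d))
     + \sum_b \sum_c D (fun a => D (fun d => g a b c d))
     + \sum_b \sum_d D (fun a => D (fun c => g a b c d))
     + \sum_c \sum_d D (fun a => D (fun b => g a b c d))
     + D (fun a => D (fun b => D (fun c => D (fun d => g a b c d))))).
Proof.
have P (f : T -> T) s : (forall h : T -> R, \sum_u h (f u) = \sum_u h u + s * D h) ->
  \sum_a \sum_b \sum_c \sum_d g (f a) (f b) (f c) (f d) =
   \sum_a \sum_b
    (\sum_c \sum_d g a b c d + s * \sum_c D (g a b c) + s * \sum_d D ((g a b)^~ d)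
    + s ^+ 2 * D (fun c => D (g a b c)))
   + s * \sum_a D (fun b =>
    (\sum_c \sum_d g a b c d + s * \sum_c D (g a b c) + s * \sum_d D ((g a b)^~ d)
    + s ^+ 2 * D (fun c => D (g a b c))))
   + s * \sum_b D (fun a =>
    (\sum_c \sum_d g a b c d + s * \sum_c D (g a b c) + s * \sum_d D ((g a b)^~ d)
    + s ^+ 2 * D (fun c => D (g a b c))))
   + s ^+ 2 * D (fun a => D (fun b =>
    (\sum_c \sum_d g a b c d + s * \sum_c D (g a b c) + s * \sum_d D ((g a b)^~ d)
    + s ^+ 2 * D (fun c => D (g a b c))))).
  move=> fE; rewrite (sum2_redirect (fun a b => \sum_c \sum_d g a b (f c) (f d)) fE).
  have E2 a b := sum2_redirect (g a b) fE.
  congr (_ + _ * _ + _ * _ + _ * _); rewrite /D ?E2 //.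
  - by apply: eq_bigr => a _; apply: eq_bigr => b _; rewrite E2.
  - by apply: eq_bigr => a _; rewrite !E2.
  - by apply: eq_bigr => a _; rewrite !E2.
rewrite (P _ 1) => [|h]; last by rewrite sum_redirect mul1r.
rewrite (P _ (-1)) => [|h]; last by rewrite sum_redirect_opp mulN1r.
have S2 (u : T -> T -> R) v w z s : \sum_a \sum_b (u a b + s * v a b + s * w a b + s^+2 * z a b)
   = \sum_a \sum_b u a b + s * \sum_a \sum_b v a b + s * \sum_a \sum_b w a b
     + s^+2 * \sum_a \sum_b z a b.
  rewrite !mulr_sumr -!big_split; apply: eq_bigr => a _.
  by rewrite !mulr_sumr -!big_split.
rewrite !S2 {S2 P} /D.
have S1 (u v w z u' v' w' z' : T -> R) s : \sum_a ((u a + s * v a + s * w a + s^+2 * z a)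
      - (u' a + s * v' a + s * w' a + s^+2 * z' a))
   = \sum_a u a + s * \sum_a v a + s * \sum_a w a + s^+2 * \sum_a z a
   - \sum_a u' a - s * \sum_a v' a - s * \sum_a w' a - s^+2 * \sum_a z' a.
  rewrite sumrB !big_split /= -!mulr_sumr; ring.
rewrite !S1 {S1}.
have Sd (u v : T -> T -> R) : \sum_a \sum_b (u a b - v a b) =
  \sum_a \sum_b u a b - \sum_a \sum_b v a b.
  by rewrite -sumrB; apply: eq_bigr => a _; rewrite sumrB.
rewrite !sumrB !Sd.
ring.
Qed.

End Convexity.
End Symmetrisation.

Section SymmetrisationStep.
Variable T : finType.
Implicit Types (A : rel T) (x y : T).

Lemma homsE (R : pzSemiRingType) A :
  (homs A)%:R = \sum_a \sum_b \sum_c \sum_d (paw A a b c d : nat)%:R :> R.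
Proof.
rewrite natr_sum; apply: eq_bigr => a _; rewrite natr_sum.
apply: eq_bigr => b _; rewrite natr_sum; apply: eq_bigr => c _.
by rewrite natr_sum.
Qed.

Lemma cherriesE (R : pzSemiRingType) A :
  (cherries A)%:R = \sum_a \sum_b \sum_c (A a b && A a c : nat)%:R :> R.
Proof.
rewrite natr_sum; apply: eq_bigr => a _; rewrite natr_sum.
by apply: eq_bigr => b _; rewrite natr_sum.
Qed.

(** In [sum4_redirect], a mixed difference in two roles joined by a red edge vanishes, because there
    are no edges on [x] and [y]; so does the fourth-order term. Only the role pairs (a,d) and (b,d)
    survive, and their sum is nonnegative. *)
Lemma homs_merge A x y : symmetric A -> irreflexive A -> ~~ A x y ->
  (homs A + homs A <= homs (merge A x y) + homs (merge A y x))%N.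
Proof.
move=> symA irrA /negPf nxy; have nyx : A y x = false by rewrite symA.
have nn : (A x x = false) * (A y y = false) * (A x y = false) * (A y x = false).
  by rewrite !irrA nxy nyx.
pose F a b c d : rat := (paw A a b c d : nat)%:R.
rewrite -(ler_nat rat) !natrD !(homsE rat).
have := sum4_redirect x y F.
rewrite {1 2}/F /paw /= => E; rewrite /merge /paw; rewrite {}E.
rewrite -/(\sum_a \sum_b \sum_c \sum_d F a b c d).
do 6! [rewrite [X in 2 * (X + _)]addrC]; rewrite -?addrA.
have F0 a b c d : ~~ A a b || ~~ A a c || ~~ A b c || ~~ A c d || A a d -> F a b c d = 0.
  by rewrite /F /paw; do 5! case: (A _ _).
have Z2 (g : T -> T -> rat) : (forall u v, g u v = 0) -> \sum_u \sum_v g u v = 0.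
  by move=> g0; apply: big1 => u _; apply: big1.
rewrite (Z2 (fun a b => F a b x x - F a b x y - (F a b y x - F a b y y))); last first.
  by move=> u v; rewrite !F0 ?nn ?orbT //; ring.
rewrite (Z2 (fun a d => F a x x d - F a x y d - (F a y x d - F a y y d))); last first.
  by move=> u v; rewrite !F0 ?nn ?orbT //; ring.
rewrite (Z2 (fun b d => F x b x d - F x b y d - (F y b x d - F y b y d))); last first.
  by move=> u v; rewrite !F0 ?nn ?orbT //; ring.
rewrite (Z2 (fun c d => F x x c d - F x y c d - (F y x c d - F y y c d))); last first.
  by move=> u v; rewrite !F0 ?nn ?orbT //; ring.
rewrite (F0 x x x x) ?nn // (F0 x x x y) ?nn // (F0 x x y x) ?nn //.
rewrite (F0 x x y y) ?nn // (F0 x y x x) ?nn // (F0 x y x y) ?nn //.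
rewrite (F0 x y y x) ?nn // (F0 x y y y) ?nn // (F0 y x x x) ?nn //.
rewrite (F0 y x x y) ?nn // (F0 y x y x) ?nn // (F0 y x y y) ?nn //.
rewrite (F0 y y x x) ?nn // (F0 y y x y) ?nn // (F0 y y y x) ?nn //.
rewrite (F0 y y y y) ?nn //.
(* the pair terms (a,d) and (b,d) combine pointwise after a change of summation order *)
have : 0 <= \sum_a \sum_c (F a x c x - F a x c y - (F a y c x - F a y c y))
     + \sum_b \sum_c (F x b c x - F x b c y - (F y b c x - F y b c y)).
  rewrite [X in X + _]exchange_big /= -big_split; apply: sumr_ge0 => b _ /=.
  rewrite -big_split; apply: sumr_ge0 => c _ /=; rewrite /F /paw.
  rewrite ?(symA b x) ?(symA c x) ?(symA b y) ?(symA c y) ?(symA c b) ?nn.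
  by case: (A x b); case: (A x c); case: (A y b); case: (A y c); case: (A b c); vm_compute.
set S := \sum_a \sum_b \sum_c \sum_d _; move=> H.
lra.
Qed.

End SymmetrisationStep.

Section SymmetrisationInduction.
Variable T : finType.
Implicit Types (A : rel T) (x y : T).

Lemma cherries_merge A x y z : symmetric A -> irreflexive A -> ~~ A x y ->
  A x z != A y z ->
  (cherries A + cherries A < cherries (merge A x y) + cherries (merge A y x))%N.
Proof.
move=> symA irrA /negPf nxy nz; have nyx : A y x = false by rewrite symA.
have nn : (A x x = false) * (A y y = false) * (A x y = false) * (A y x = false).
  by rewrite !irrA nxy nyx.
have n0 : (0 : rat) < #|T|%:R by rewrite ltr0n; apply/card_gt0P; exists x.
pose F a b c : rat := (A a b && A a c : nat)%:R.
(* A dummy fourth variable makes [sum4_redirect] applicable, at the price of a factor [#|T|]. *)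
have E (B : rel T) : (cherries B)%:R * #|T|%:R =
    \sum_a \sum_b \sum_c \sum_(d : T) (B a b && B a c : nat)%:R :> rat.
  rewrite cherriesE !mulr_suml; apply: eq_bigr => a _; rewrite !mulr_suml.
  apply: eq_bigr => b _; rewrite !mulr_suml; apply: eq_bigr => c _.
  by rewrite sumr_const mulr_natr.
rewrite -(ltr_nat rat) !natrD -(ltr_pM2r n0) !mulrDl !E.
have := sum4_redirect x y (fun a b c (_ : T) => F a b c).
rewrite {1 2}/F /= => K; rewrite /merge {}K.
rewrite -/(\sum_a \sum_b \sum_c \sum_(d : T) F a b c).
have Z2 (g : T -> T -> rat) : (forall u v, g u v = 0) -> \sum_u \sum_v g u v = 0.
  by move=> g0; apply: big1 => u _; apply: big1.
rewrite (Z2 (fun a b => F a b x - F a b x - (F a b y - F a b y))); last by move=> *; ring.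
rewrite (Z2 (fun a c => F a x c - F a x c - (F a y c - F a y c))); last by move=> *; ring.
rewrite (Z2 (fun b c => F x b c - F x b c - (F y b c - F y b c))); last by move=> *; ring.
rewrite (Z2 (fun b (d : T) => F x b x - F x b y - (F y b x - F y b y))); last first.
  by move=> u v; rewrite /F !nn !andbF; ring.
rewrite (Z2 (fun c (d : T) => F x x c - F x y c - (F y x c - F y y c))); last first.
  by move=> u v; rewrite /F !nn /=; ring.
(* The second-order term in (b,c) counts, [#|T|] times each, the vertices adjacent to exactly one of
   [x] and [y]; [z] is one of them. *)
have : 0 < \sum_a \sum_(d : T) (F a x x - F a x y - (F a y x - F a y y)).
  have H a : F a x x - F a x y - (F a y x - F a y y) = (A x a != A y a : nat)%:R.
    by rewrite /F !(symA a); case: (A x a); case: (A y a); rewrite /=; ring.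
  under eq_bigr do (rewrite sumr_const H).
  rewrite (bigD1 z) //= nz ltr_pwDl //; last first.
    by apply: sumr_ge0 => u _; exact: mulrn_wge0.
rewrite /F !nn /= => pos; lra.
Qed.

(* The number of homomorphisms is tracked lexicographically with the number of
   cherries, which is strictly convex along merges. *)
Lemma merge_ind (P : rel T -> Prop) :
  (forall A, symmetric A -> irreflexive A ->
     (forall x y z, ~~ A x y -> A x z = A y z) -> P A) ->
  (forall A x y, symmetric A -> irreflexive A ->
     (homs A <= homs (merge A x y))%N -> P (merge A x y) -> P A) ->
  forall A, symmetric A -> irreflexive A -> P A.
Proof.
move=> Pbase Pstep.
(* [M] exceeds every number of cherries, which makes [phi] lexicographic; the induction is on the
   distance of [phi A] from its upper bound [N]. *)
pose M := (#|T| * (#|T| * #|T|)).+1; pose phi A := (M * homs A + cherries A)%N.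
have sb (g : T -> nat) m : (forall u, g u <= m)%N -> (\sum_u g u <= #|T| * m)%N.
  by move=> gm; rewrite -sum_nat_const; apply: leq_sum => u _.
have chM A : (cherries A < M)%N.
  rewrite ltnS; apply: (sb) => a; apply: (sb) => b.
  by rewrite -[X in (_ <= X)%N]muln1; apply: (sb) => c; apply: leq_b1.
pose N := (M * (#|T| * (#|T| * (#|T| * #|T|))) + M)%N.
have phiN A : (phi A < N)%N.
  rewrite /phi /N -addnS leq_add // leq_mul //; do 3! apply: (sb) => ?.
  by rewrite -[X in (_ <= X)%N]muln1; apply: (sb) => c; apply: leq_b1.
have step A x y : symmetric A -> irreflexive A -> (phi A < phi (merge A x y))%N ->
    (homs A <= homs (merge A x y))%N.
  move=> _ _; rewrite /phi => lt; rewrite leqNgt; apply/negP => lth.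
  have : (M * (homs (merge A x y)).+1 <= M * homs A)%N by rewrite leq_mul2l lth orbT.
  move: (chM (merge A x y)) lt; lia.
move=> A symA irrA; move: {2}(N - phi A)%N (leqnn (N - phi A)%N) => k.
elim: k A symA irrA => [|k IH] A symA irrA.
  by rewrite leqn0 subn_eq0 leqNgt phiN.
move=> leN.
case: (boolP [exists x, [exists y, [exists z, ~~ A x y && (A x z != A y z)]]]); last first.
  move=> nex; apply: Pbase => // x y z nxy; apply/eqP; apply: contraR nex => nz.
  by apply/existsP; exists x; apply/existsP; exists y; apply/existsP; exists z; rewrite nxy.
case/existsP=> x /existsP [y /existsP [z /andP [nxy nz]]].
have h1 := homs_merge symA irrA nxy; have h2 := cherries_merge symA irrA nxy nz.
have : (phi A < phi (merge A x y))%N || (phi A < phi (merge A y x))%N.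
  rewrite !ltnNge -negb_and; apply/negP => /andP [l1 l2].
  have := leq_add l1 l2; rewrite /phi.
  have : (M * (homs A + homs A) <= M * (homs (merge A x y) + homs (merge A y x)))%N.
    by rewrite leq_mul2l h1 orbT.
  lia.
have fin u v : (phi A < phi (merge A u v))%N -> P A.
  move=> lt; apply: (Pstep _ u v) => //; first exact: step.
  apply: IH; [exact: merge_sym|exact: merge_irr|].
  move: (phiN (merge A u v)) leN lt; lia.
by case/orP; apply: fin.
Qed.

End SymmetrisationInduction.

(** * Complete multipartite graphs and their weight polynomial *)

Definition blow (T : Type) (K : eqType) (p : T -> K) : rel T := fun u v => p u != p v.

Section Multipartite.
Variables (R : realFieldType) (K : finType).
Implicit Types w : K -> R.

(** The non-adjacent vertices 0 and 3 share a part [i], and 1 and 2 lie in two distinct parts other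
    than [i]: the squared weight outside [i], less the pairs within one part. *)
Definition paw_poly w : R :=
  \sum_i w i ^+ 2 *
    ((\sum_j w j - w i) ^+ 2 - (\sum_j w j ^+ 2 - w i ^+ 2)).

Definition part_size (T : finType) (p : T -> K) (i : K) : R := #|[set u | p u == i]|%:R.

Lemma part_sizeE (T : finType) (p : T -> K) i :
  part_size p i = \sum_u (p u == i : nat)%:R.
Proof.
rewrite /part_size -sum1_card natr_sum [RHS](bigID (fun u => p u == i)) /=.
rewrite [X in _ = _ + X]big1 => [|u /negPf -> //]; rewrite addr0.
by apply: eq_big => u; rewrite ?inE // => ->.
Qed.

Lemma sum_by_part (T : finType) (p : T -> K) (y : T -> R) (g : K -> R) :
  \sum_u y u * g (p u) = \sum_i (\sum_(u | p u == i) y u) * g i.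
Proof.
rewrite (partition_big p xpredT) //=; apply: eq_bigr => i _.
by rewrite mulr_suml; apply: eq_bigr => u /eqP <-.
Qed.

Lemma sum_part_const (T : finType) (p : T -> K) (g : K -> R) :
  \sum_u g (p u) = \sum_i part_size p i * g i.
Proof.
have := sum_by_part p (fun=> 1) g; under eq_bigr do rewrite mul1r.
move=> ->; apply: eq_bigr => i _; congr (_ * _).
by rewrite /part_size -sum1_card natr_sum; apply: eq_bigl => u; rewrite inE.
Qed.

Lemma sum_part_size (T : finType) (p : T -> K) : \sum_i part_size p i = #|T|%:R.
Proof.
have := sum_part_const p (fun=> 1); under [RHS]eq_bigr do rewrite mulr1.
by move=> <-; rewrite sumr_const.
Qed.

Lemma homs_blow (T : finType) (p : T -> K) :
  (homs (blow p))%:R = paw_poly (part_size p).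
Proof.
rewrite homsE /paw_poly sum_part_size.
set n : R := #|T|%:R.
have cE i j : i != j -> \sum_(c : T) ((i != p c) && (j != p c) : nat)%:R =
   n - part_size p i - part_size p j.
  move=> nij; rewrite !part_sizeE /n -sum1_card natr_sum -!sumrB.
  apply: eq_bigr => c _; rewrite ![_ == p c]eq_sym.
  by case: eqP => [->|] /=; rewrite ?(negPf nij) ?subrr ?subr0 //; case: eqP => _ /=; lra.
transitivity (\sum_a part_size p (p a) * ((n - part_size p (p a)) ^+ 2
   - (\sum_j part_size p j ^+ 2 - part_size p (p a) ^+ 2))); last first.
  rewrite (sum_part_const p (fun i => part_size p i * ((n - part_size p i) ^+ 2
     - (\sum_j part_size p j ^+ 2 - part_size p i ^+ 2)))).
  by apply: eq_bigr => i _; rewrite expr2 mulrA.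
apply: eq_bigr => a _.
(* For fixed [a] and [b], the choices of [c] and [d] are independent: [d] lies in the part of [a],
   and [c] outside the parts of [a] and [b]. *)
transitivity (\sum_b (p a != p b : nat)%:R * (part_size p (p a) *
    (n - part_size p (p a) - part_size p (p b)))).
  apply: eq_bigr => b _; case: eqVneq => [ab|nab] /=.
    rewrite mul0r big1 // => c _; rewrite big1 // => d _.
    by rewrite /paw /blow ab eqxx.
  rewrite mul1r -(cE _ _ nab) mulr_sumr; apply: eq_bigr => c _.
  rewrite part_sizeE mulr_suml; apply: eq_bigr => d _.
  rewrite /paw /blow nab negbK (eq_sym (p d)) /= -natrM mulnb.
  case: (eqVneq (p a) (p d)) => [<-|]; last by rewrite !andbF.
  by rewrite andbT /= (eq_sym (p c)); do 2 case: (_ == _).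
rewrite (sum_part_const p (fun i => (p a != i : nat)%:R * (part_size p (p a) *
    (n - part_size p (p a) - part_size p i)))).
rewrite [in RHS](bigD1 (p a)) //= (bigD1 (p a)) //= eqxx mul0r mulr0 add0r.
have -> : n = part_size p (p a) + \sum_(i | i != p a) part_size p i.
  by rewrite /n -(sum_part_size p) (bigD1 (p a)).
set s := part_size p (p a).
rewrite (eq_bigr (fun i => s * ((\sum_(i | i != p a) part_size p i) * part_size p i
   - part_size p i ^+ 2))); last first.
  by move=> i ni; rewrite eq_sym ni mul1r; ring.
rewrite -mulr_sumr sumrB -mulr_sumr; ring.
Qed.

Lemma paw_polyE w : \sum_i w i = 1 ->
  paw_poly w = \sum_i (w i ^+ 2 - 2 * w i ^+ 3 + 2 * w i ^+ 4) - (\sum_i w i ^+ 2) ^+ 2.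
Proof.
move=> w1; rewrite /paw_poly w1 expr2 [in X in _ - X]mulr_suml -sumrB.
by apply: eq_bigr => i _; ring.
Qed.

Lemma paw_polyZ c w : paw_poly (fun i => c * w i) = c ^+ 4 * paw_poly w.
Proof.
rewrite /paw_poly mulr_sumr; apply: eq_bigr => i _.
rewrite -mulr_sumr; under [\sum_j (c * w j) ^+ 2]eq_bigr do rewrite exprMn.
rewrite -mulr_sumr; ring.
Qed.

(* [- q ^+ 2 <= mu ^+ 2 - 2 * mu * q] linearises the concave term; [lam] is a
   Lagrange multiplier. *)
Lemma paw_poly_linearised w mu lam : \sum_i w i = 1 ->
  paw_poly w <= mu ^+ 2 + lam + \sum_i ((1 - 2 * mu) * w i ^+ 2 - 2 * w i ^+ 3
      + 2 * w i ^+ 4 - lam * w i).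
Proof.
move=> w1; rewrite paw_polyE // !(sumrB, big_split) /= -!mulr_sumr w1.
have := sqr_ge0 (\sum_i w i ^+ 2 - mu); nra.
Qed.

(** With the tangent at [mu = w k ^+ 2] the part [k] and the constant give
    [(w k * (1 - w k)) ^+ 2 <= 1 / 16], while every other part gives at most [w i / 27], hence at
    most 1/54 in total. *)
Lemma paw_poly_large_part w k : (forall i, 0 <= w i) -> \sum_i w i = 1 ->
  1/2 <= w k -> paw_poly w <= 12 / 125 - 1 / 2000.
Proof.
move=> w0 w1 wk.
have lin := paw_poly_linearised (w k ^+ 2) 0 w1.
apply: le_trans lin _; rewrite (bigD1 k) //=.
have wk1 : w k + \sum_(i | i != k) w i = 1 by rewrite -[RHS]w1 [RHS](bigD1 k).
have bnd i : i != k -> (1 - 2 * w k ^+ 2) * w i ^+ 2 - 2 * w i ^+ 3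
      + 2 * w i ^+ 4 - 0 * w i <= 1 / 27 * w i.
  move=> ni; have wi : w i <= 1 / 2.
    move: wk1; rewrite (bigD1 i) //=.
    have : 0 <= \sum_(j | (j != k) && (j != i)) w j by apply: sumr_ge0.
    lra.
  have wi0 := w0 i.
  have h : w i * (1 - 2 * w i) ^+ 2 <= 2 / 27.
    have : 0 <= (1 / 6 - w i) ^+ 2 * (2 / 3 - w i) by rewrite mulr_ge0 ?sqr_ge0; lra.
    nra.
  have h2 : w i ^+ 2 * (1 - 2 * w k ^+ 2) <= w i ^+ 2 * (1 / 2).
    apply: ler_wpM2l; first exact: sqr_ge0.
    nra.
  have : w i * (w i * (1 - 2 * w i) ^+ 2) <= w i * (2 / 27) by apply: ler_wpM2l.
  nra.
have le2 : \sum_(i | i != k) ((1 - 2 * w k ^+ 2) * w i ^+ 2 - 2 * w i ^+ 3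
      + 2 * w i ^+ 4 - 0 * w i) <= 1 / 27 * \sum_(i | i != k) w i.
  by rewrite mulr_sumr; apply: ler_sum.
have wkb : w k <= 1.
  have : 0 <= \sum_(i | i != k) w i by apply: sumr_ge0.
  lra.
have : (w k * (1 - w k)) ^+ 2 <= (1 / 4) ^+ 2.
  rewrite lerXn2r ?nnegrE ?mulr_ge0 //; try lra.
  have := sqr_ge0 (w k - 1 / 2); nra.
nra.
Qed.

(** The tangent point 1/4 is the sum of squares of four equal parts. The multiplier 17/1000 makes
    parts below 1/25 contribute nothing positive, and at most four others contribute at most
    39/10000 each. *)
Lemma paw_poly_few_parts w : (forall i, 0 <= w i) -> \sum_i w i = 1 ->
  (forall i, w i <= 1 / 2) -> (#|[set i | (1 / 25 <= w i)%R]| <= 4)%N ->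
  paw_poly w <= 12 / 125 - 1 / 2000.
Proof.
move=> w0 w1 wh S4.
apply: le_trans (paw_poly_linearised (1 / 4) (17 / 1000) w1) _.
rewrite (bigID (mem [set i | 1 / 25 <= w i])) /=.
have b1 i : i \in [set i | 1 / 25 <= w i] -> (1 - 2 * (1 / 4)) * w i ^+ 2 - 2 * w i ^+ 3
      + 2 * w i ^+ 4 - 17 / 1000 * w i <= 39 / 100 / 100.
  move=> _; have := w0 i; have := wh i; move: (w i) => a a1 a0.
  pose z := a * (1 - 2 * a).
  suff : z ^+ 2 / 2 - 17 / 1000 * a <= 39 / 100 / 100 by rewrite /z; nra.
  have zb : z <= 1 / 8 by rewrite /z; have := sqr_ge0 (a - 1 / 4); nra.
  have z0 : 0 <= z by rewrite /z mulr_ge0 //; lra.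
  have [ha|ha] := lerP a (235 / 1000).
    have : z <= a * (1 - 2 * a) by [].
    have q := sqr_ge0 (a - 21 / 100).
    rewrite /z in z0 zb *; nra.
  nra.
have b2 i : i \notin [set i | 1 / 25 <= w i] -> (1 - 2 * (1 / 4)) * w i ^+ 2 - 2 * w i ^+ 3
      + 2 * w i ^+ 4 - 17 / 1000 * w i <= 0.
  rewrite inE -ltNge => wi; have := w0 i; move: (w i) wi => a a1 a0.
  have : 0 <= (1 / 25 - a) * a by rewrite mulr_ge0 //; lra.
  nra.
set S := [set i | 1 / 25 <= w i] in b1 b2 S4 *.
pose h i := (1 - 2 * (1 / 4)) * w i ^+ 2 - 2 * w i ^+ 3 + 2 * w i ^+ 4 - 17 / 1000 * w i.
have h1 : \sum_(i in S) h i <= (39 / 100 / 100) * #|S|%:R.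
  by rewrite mulr_natr -sumr_const; apply: ler_sum.
have h2 : \sum_(i | i \notin S) h i <= 0 by apply: sumr_le0.
have : (#|S|%:R : R) <= 4 by rewrite (ler_nat _ _ 4).
rewrite -/h; move: h1 h2; rewrite /h; lra.
Qed.

End Multipartite.

(** * Stability of the optimal part weights *)

Section MultipartiteStability.
Variables (R : realFieldType) (K : finType).
Implicit Types w : K -> R.

(** If five or more parts have weight at least 1/25, each of them contributes at most -1/625 to the
    linearised bound. Exactly five give 12/125; a sixth lowers the bound by more than 1/2000. *)
Lemma paw_poly_stability w : (forall i, 0 <= w i) -> \sum_i w i = 1 ->
  paw_poly w <= 12 / 125 - 1 / 2000 \/
  exists2 S : {set K}, #|S| = 5 &
    paw_poly w + 7 / 1000 * \sum_(i | i \notin S) w i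
      + 3 / 625 * \sum_(i in S) (w i - 1 / 5) ^+ 2 <= 12 / 125.
Proof.
move=> w0 w1; case: (boolP [exists k, 1 / 2 <= w k]) => [/existsP [k wk]|nwk].
  by left; apply: paw_poly_large_part wk.
have wh i : w i <= 1 / 2.
  by case: (lerP (w i) (1 / 2)) => // /ltW h; case/existsP: nwk; exists i.
have [S4|S5] := leqP #|[set i | (1 / 25 <= w i)%R]| 4.
  by left; apply: paw_poly_few_parts.
(* 1/5 is the sum of squares of five equal weights, and the multiplier 8/125 makes the summand [h]
   stationary at weight 1/5. *)
have lin := paw_poly_linearised (1 / 5) (8 / 125) w1.
pose h i := (1 - 2 * (1 / 5)) * w i ^+ 2 - 2 * w i ^+ 3 + 2 * w i ^+ 4 - 8 / 125 * w i.
set S := [set i | _] in S5.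
(* At weight [a], [h + 1 / 625] is [(a - 1 / 5) ^+ 2] times the convex quadratic
   [2 * a ^+ 2 - 12 / 10 * a + 4 / 100], which on [1/25, 1/2] is largest at 1/25, with value
   -3/625. *)
have h1 i : i \in S -> h i <= - (1 / 625) - 3 / 625 * (w i - 1 / 5) ^+ 2.
  rewrite inE => wi; have := wh i; rewrite /h; move: (w i) wi => a a1 a2.
  have : 0 <= (1 / 2 - a) * (a - 1 / 25) by rewrite mulr_ge0 // subr_ge0.
  move=> a12.
  have : 0 <= (a - 1 / 5) ^+ 2 * (- (2 * a ^+ 2 - 12 / 10 * a + 4 / 100) - 3 / 625 / 2).
    rewrite mulr_ge0 ?sqr_ge0 //; nra.
  have := sqr_ge0 (a - 1 / 5); nra.
have h2 i : i \notin S -> h i <= - (7 / 1000) * w i.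
  rewrite inE -ltNge /h => wi; have := w0 i; move: (w i) wi => a a1 a0.
  have : a * (3 / 5 * a - 2 * a ^+ 2 + 2 * a ^+ 3 - 8 / 125) <= a * (- (7 / 1000)).
    by apply: ler_wpM2l => //; nra.
  nra.
have s1 : \sum_(i in S) h i <=
    - (1 / 625) * #|S|%:R - 3 / 625 * \sum_(i in S) (w i - 1 / 5) ^+ 2.
  rewrite mulr_natr -sumr_const mulr_sumr -sumrB; apply: ler_sum => i iS.
  exact: h1.
have s2 : \sum_(i | i \notin S) h i <= - (7 / 1000) * \sum_(i | i \notin S) w i.
  by rewrite mulr_sumr; apply: ler_sum.
have {}lin : paw_poly w <= (1 / 5) ^+ 2 + 8 / 125 +
    (\sum_(i in S) h i + \sum_(i | i \notin S) h i).
  by move: lin; rewrite (bigID (mem S)).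
have [S5'|S6] := eqVneq #|S| 5.
  right; exists S => //; move: s1 s2 lin; rewrite S5'; lra.
left; have : (6 <= (#|S|)%:R :> R) by rewrite (ler_nat _ 6) ltn_neqAle eq_sym S6.
have q0 : 0 <= \sum_(i in S) (w i - 1 / 5) ^+ 2 by apply: sumr_ge0 => *; apply: sqr_ge0.
have v0 : 0 <= \sum_(i | i \notin S) w i by apply: sumr_ge0.
lra.
Qed.

Lemma paw_poly_le w : (forall i, 0 <= w i) -> \sum_i w i = 1 -> paw_poly w <= 12 / 125.
Proof.
move=> w0 w1; case: (paw_poly_stability w0 w1) => [|[S _]]; first by lra.
have q0 : 0 <= \sum_(i in S) (w i - 1 / 5) ^+ 2 by apply: sumr_ge0 => *; apply: sqr_ge0.
have v0 : 0 <= \sum_(i | i \notin S) w i by apply: sumr_ge0.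
lra.
Qed.

Lemma paw_poly_stability5 w : #|K| = 5 -> (forall i, 0 <= w i) -> \sum_i w i = 1 ->
  12 / 125 - 1 / 2000 < paw_poly w ->
  paw_poly w + 3 / 625 * \sum_i (w i - 1 / 5) ^+ 2 <= 12 / 125.
Proof.
move=> K5 w0 w1 large; case: (paw_poly_stability w0 w1) => [|[S S5]]; first by lra.
have -> : S = [set: K] by apply/eqP; rewrite eqEcard subsetT cardsT S5 K5.
by rewrite big1 => [|i]; rewrite ?inE // mulr0 addr0; under eq_bigl do rewrite inE.
Qed.

Variable T : finType.
Implicit Types p : T -> K.

Lemma part_weight_ge0 p i : 0 <= (#|T|%:R)^-1 * part_size R p i.
Proof. by rewrite mulr_ge0 ?invr_ge0 ?ler0n. Qed.

Lemma part_weight_sum p : (0 < #|T|)%N -> \sum_i (#|T|%:R)^-1 * part_size R p i = 1.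
Proof.
move=> n0; rewrite -mulr_sumr sum_part_size mulVf //.
by rewrite pnatr_eq0 -lt0n.
Qed.

Lemma homs_blow_weight p : (0 < #|T|)%N -> (homs (blow p))%:R =
  #|T|%:R ^+ 4 * paw_poly (fun i => (#|T|%:R)^-1 * part_size R p i).
Proof.
move=> n0; rewrite paw_polyZ exprVn mulrA mulfV ?mul1r ?homs_blow //.
by rewrite expf_neq0 // pnatr_eq0 -lt0n.
Qed.

End MultipartiteStability.

(** * The upper bound, and closeness for multipartite graphs *)

Section Closeness.
Variable T : finType.
Implicit Types A : rel T.

(** Pairs are ordered here, so for symmetric [A] each wrong pair counts twice. *)
Definition disc A (p : T -> 'I_5) : nat :=
  (\sum_u \sum_v (A u v != blow p u v))%N.

Lemma eq_homs A B : A =2 B -> homs A = homs B.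
Proof. by move=> E; do 4! apply: eq_bigr => ? _; rewrite /paw !E. Qed.

(** Non-adjacent vertices are twins, so the neighbourhoods can serve as labels of the parts. *)
Lemma multipartite_blow A : symmetric A -> irreflexive A ->
  (forall x y z, ~~ A x y -> A x z = A y z) ->
  A =2 blow (fun u => [set v | A u v]).
Proof.
move=> symA irrA mA u v; rewrite /blow; case Auv: (A u v); apply/esym.
  by apply/eqP => /setP /(_ v); rewrite !inE Auv irrA.
by apply/negbTE; rewrite negbK; apply/eqP/setP => z; rewrite !inE (mA u v) ?Auv.
Qed.

Lemma homs_le (R : realFieldType) A : symmetric A -> irreflexive A ->
  (homs A)%:R <= 12 / 125 * #|T|%:R ^+ 4 :> R.
Proof.
move=> symA irrA.
have [T0|n0] := posnP #|T|.
  rewrite T0 expr0n mulr0 /homs big1 // => a _.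
  by have := fintype0 a T0.
move: A symA irrA; apply: merge_ind => [A symA irrA mA|A x y _ _ le1 le2].
  rewrite (eq_homs (multipartite_blow symA irrA mA)).
  rewrite homs_blow_weight // mulrC ler_wpM2r ?exprn_ge0 //.
  by apply: paw_poly_le => [i|]; [apply: part_weight_ge0|apply: part_weight_sum].
by apply: le_trans le2; rewrite ler_nat.
Qed.

(** By [paw_poly_stability] the weight outside the five parts in [S] is at most 150 [e], and every
    wrong pair has a vertex there. *)
Lemma multipartite_close (R : realFieldType) (e : R) A :
  symmetric A -> irreflexive A -> (forall x y z, ~~ A x y -> A x z = A y z) ->
  (0 < #|T|)%N -> e < 1 / 2000 ->
  (12 / 125 - e) * #|T|%:R ^+ 4 <= (homs A)%:R ->
  exists p, (disc A p)%:R <= 300 * e * #|T|%:R ^+ 2.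
Proof.
move=> symA irrA mA n0 e1.
have AE := multipartite_blow symA irrA mA; set q := (fun u => _) in AE.
have nR : 0 < #|T|%:R :> R by rewrite ltr0n.
rewrite (eq_homs AE) homs_blow_weight // mulrC ler_pM2l ?exprn_gt0 // => large.
have := paw_poly_stability (part_weight_ge0 R q) (part_weight_sum R q n0).
case=> [|[S S5 stab]]; first lra.
have q0 : 0 <= \sum_(i in S) (#|T|%:R^-1 * part_size R q i - 1 / 5) ^+ 2.
  by apply: sumr_ge0 => *; apply: sqr_ge0.
pose L : R := \sum_u (q u \notin S : nat)%:R.
have LE : #|T|%:R * \sum_(i | i \notin S) #|T|%:R^-1 * part_size R q i = L.
  rewrite -mulr_sumr mulrA mulfV ?mul1r ?gt_eqF // /L.
  rewrite (sum_part_const q (fun i => (i \notin S : nat)%:R : R)) [RHS](bigID (mem S)) /=.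
  rewrite [X in _ = X + _]big1 => [|i ->]; last by rewrite mulr0.
  rewrite add0r; apply: eq_bigr => i iS. by rewrite iS mulr1.
(* Outside [S] the index is 5 and [inord] returns its default; the class of such a vertex is
   irrelevant. *)
pose p u : 'I_5 := inord (index (q u) (enum S)).
have idx u : q u \in S -> (index (q u) (enum S) < 5)%N.
  by move=> uS; rewrite -[5%N]S5 cardE index_mem mem_enum.
have pq u v : q u \in S -> q v \in S -> blow p u v = blow q u v.
  move=> uS vS; rewrite /blow /p -val_eqE /= !inordK ?idx //.
  congr (~~ _); apply/eqP/eqP => [|-> //].
  by move=> /(congr1 (nth (q u) (enum S))); rewrite !nth_index ?mem_enum.
exists p; have dL : (disc A p)%:R <= 2 * #|T|%:R * L.
  have -> : 2 * #|T|%:R * L =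
      \sum_u \sum_v ((q u \notin S : nat)%:R + (q v \notin S : nat)%:R).
    transitivity (\sum_u ((q u \notin S : nat)%:R * #|T|%:R + L)).
      by rewrite big_split /= -mulr_suml sumr_const -/L -[L *+ _]mulr_natr; ring.
    apply: eq_bigr => u _; rewrite big_split /= sumr_const -/L; congr (_ + _).
    by rewrite mulr_natr.
  rewrite natr_sum; apply: ler_sum => u _; rewrite natr_sum; apply: ler_sum => v _.
  rewrite AE; have := pq u v; case: (q u \in S); case: (q v \in S) => /= h.
  - by rewrite h // eqxx addr0.
  - by rewrite add0r ler_nat leq_b1.
  - by rewrite addr0 ler_nat leq_b1.
  - by apply: le_trans (_ : 1%:R <= _); rewrite ?ler_nat ?leq_b1 // lerDl.
apply: le_trans dL _; rewrite -LE.
set V := \sum_(i | _) _ in stab LE *.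
have V0 : 0 <= V by apply: sumr_ge0 => i _; apply: part_weight_ge0.
have : V <= 150 * e by lra.
move: (exprn_gt0 2 nR); nra.
Qed.

End Closeness.

(** * First-order expansion around a blowup *)

Section LocalExpansion.
Variable R : realFieldType.

(** One step of expanding a product factor by factor: [L] is the linear part of [P - Q], and [D] and
    [S] bound the difference and the remainder. The remainder thus collects only products of two
    errors. *)
Lemma prod_linear_step (P Q L S D b x e : R) :
  0 <= b <= 1 -> `|P| <= 1 -> `|P - Q| <= D -> `|P - Q - L| <= S -> `|x - b| = e ->
  `|P * x - Q * b| <= D + e /\
  `|P * x - Q * b - (L * b + Q * (x - b))| <= S + D * e.
Proof.
move=> /andP [b0 b1] P1 PQ PQL xe; have e0 : 0 <= e by rewrite -xe.
split.
  have -> : P * x - Q * b = (P - Q) * b + P * (x - b) by ring.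
  apply: le_trans (ler_normD _ _) _; rewrite !normrM xe (ger0_norm b0).
  apply: lerD; first by rewrite -[D]mulr1 ler_pM.
  by rewrite -[X in _ <= X]mul1r ler_wpM2r.
have -> : P * x - Q * b - (L * b + Q * (x - b)) =
   (P - Q - L) * b + (P - Q) * (x - b) by ring.
apply: le_trans (ler_normD _ _) _; rewrite !normrM xe (ger0_norm b0).
apply: lerD; first by rewrite -[S]mulr1 ler_pM.
by rewrite ler_wpM2r.
Qed.

Local Notation "b %:B" := (((b : bool) : nat)%:R : R) (at level 2, left associativity, format "b %:B").

Lemma prod5_linear (x1 x2 x3 x4 x5 b1 b2 b3 b4 b5 : bool) :
  `|x1%:B * x2%:B * x3%:B * x4%:B * x5%:B - b1%:B * b2%:B * b3%:B * b4%:B * b5%:B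
   - ((x1%:B - b1%:B) * b2%:B * b3%:B * b4%:B * b5%:B
      + b1%:B * (x2%:B - b2%:B) * b3%:B * b4%:B * b5%:B
      + b1%:B * b2%:B * (x3%:B - b3%:B) * b4%:B * b5%:B
      + b1%:B * b2%:B * b3%:B * (x4%:B - b4%:B) * b5%:B
      + b1%:B * b2%:B * b3%:B * b4%:B * (x5%:B - b5%:B))|
  <= (x1 != b1)%:B * (x2 != b2)%:B + ((x1 != b1)%:B + (x2 != b2)%:B) * (x3 != b3)%:B
   + ((x1 != b1)%:B + (x2 != b2)%:B + (x3 != b3)%:B) * (x4 != b4)%:B
   + ((x1 != b1)%:B + (x2 != b2)%:B + (x3 != b3)%:B + (x4 != b4)%:B) * (x5 != b5)%:B.
Proof.
pose x (b : bool) : R := b%:B; pose e (a b : bool) : R := (a != b)%:B.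
have x01 b : 0 <= x b <= 1 by case: b => /=; rewrite /x /= ?lexx ?ler01.
have xe a b : `|x a - x b| = e a b.
  by case: a; case: b; rewrite /x /e /= ?subrr ?subr0 ?sub0r ?normrN ?normr0 ?normr1.
have xM a b : x a * x b = x (a && b) by rewrite /x -natrM mulnb.
have xn b : `|x b| <= 1 by rewrite ger0_norm; case/andP: (x01 b).
have s1 : `|x x1 - x b1 - (x x1 - x b1)| <= 0 by rewrite subrr normr0.
have d1 : `|x x1 - x b1| <= e x1 b1 by rewrite xe.
have [d2 s2] := prod_linear_step (x01 b2) (xn x1) d1 s1 (xe x2 b2).
have n2 : `|x x1 * x x2| <= 1 by rewrite xM.
have [d3 s3] := prod_linear_step (x01 b3) n2 d2 s2 (xe x3 b3).
have n3 : `|x x1 * x x2 * x x3| <= 1 by rewrite !xM.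
have [d4 s4] := prod_linear_step (x01 b4) n3 d3 s3 (xe x4 b4).
have n4 : `|x x1 * x x2 * x x3 * x x4| <= 1 by rewrite !xM.
have [_] := prod_linear_step (x01 b5) n4 d4 s4 (xe x5 b5).
rewrite add0r /x /e => le; apply: le_trans le.
rewrite le_eqVlt; apply/orP; left; apply/eqP; congr `| _ |; ring.
Qed.

(* The coefficient in the linear term of the wrongness of a pair in classes i, j,
   contributed by the other two vertices being in classes k, l; one summand for
   each of the pairs ab, ac, bc, cd, ad of the paw. *)
Definition paw_coef (i j k l : 'I_5) : R :=
  ([&& i != k, j != k, k != l & i == l] : nat)%:R
  + ([&& i != k, k != j, j != l & i == l] : nat)%:R
  + ([&& k != i, k != j, j != l & k == l] : nat)%:R
  + ([&& k != l, k != i, l != i & k == j] : nat)%:R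
  - ([&& i != k, i != l, k != l & l != j] : nat)%:R.

(** In units of a squared part size, an ordered pair becoming adjacent within a part creates 8
    copies and destroys 12; between parts it creates 12 and destroys 9. Hence both kinds of wrong
    pair lose copies. *)
Lemma sum_paw_coef i j : \sum_k \sum_l paw_coef i j k l = if i == j then - 4 else 3.
Proof.
rewrite /paw_coef; pose F (i j : 'I_5) : int := \sum_k \sum_l (
  ([&& i != k, j != k, k != l & i == l] : nat)%:Z
  + ([&& i != k, k != j, j != l & i == l] : nat)%:Z
  + ([&& k != i, k != j, j != l & k == l] : nat)%:Z
  + ([&& k != l, k != i, l != i & k == j] : nat)%:Z
  - ([&& i != k, i != l, k != l & l != j] : nat)%:Z).
transitivity ((F i j)%:~R : R).
  rewrite /F rmorph_sum; apply: eq_bigr => k _; rewrite rmorph_sum; apply: eq_bigr => l _.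
  by rewrite /= rmorphB !rmorphD /= -!pmulrn.
have -> : F i j = if i == j then - 4 else 3.
  rewrite /F !big_ord_recl !big_ord0.
  by move: i j; do 2! [case; do 5? [case => //] => ?].
by case: eqP => _; rewrite ?mulrNz.
Qed.

End LocalExpansion.

Lemma mul_near (R : realFieldType) (x y z e : R) : 0 <= z ->
  `|x - z| <= e -> `|y - z| <= e -> `|x * y - z ^+ 2| <= e * (2 * z + e).
Proof.
move=> z0 xe ye; have e0 : 0 <= e by apply: le_trans xe.
have -> : x * y - z ^+ 2 = (x - z) * (y - z) + z * ((x - z) + (y - z)) by ring.
apply: le_trans (ler_normD _ _) _; rewrite !normrM (ger0_norm z0).
have m1 : `|x - z| * `|y - z| <= e * e by rewrite ler_pM.
have m2 : z * `|x - z + (y - z)| <= z * (e + e).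
  by rewrite ler_wpM2l //; apply: le_trans (ler_normD _ _) _; apply: lerD.
lra.
Qed.

(** * The loss when every vertex has few wrong pairs *)

Section SmallDegreeDiscrepancy.
Variables (R : realFieldType) (T : finType).
Variables (A : rel T) (p : T -> 'I_5).
Hypothesis symA : symmetric A.
Implicit Types u v a b c d : T.

Local Notation B := (blow p).
Local Notation n := (#|T|%:R : R).
Local Notation "b %:B" := (((b : bool) : nat)%:R : R) (at level 2, left associativity, format "b %:B").

Let dev u v : R := (A u v)%:B - (B u v)%:B.
Let wrong u v : R := (A u v != B u v)%:B.

Lemma blow_sym : symmetric B.
Proof. by move=> u v; rewrite /blow eq_sym. Qed.

Lemma disc_sum : (disc A p)%:R = \sum_u \sum_v wrong u v.
Proof. by rewrite natr_sum; apply: eq_bigr => u _; rewrite natr_sum. Qed.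

Lemma sum2_part (g : 'I_5 -> 'I_5 -> R) :
  \sum_u \sum_v g (p u) (p v) =
  \sum_k \sum_l part_size R p k * part_size R p l * g k l.
Proof.
transitivity (\sum_u \sum_l part_size R p l * g (p u) l).
  by apply: eq_bigr => u _; rewrite (sum_part_const p (g (p u))).
rewrite (sum_part_const p (fun k => \sum_l part_size R p l * g k l)).
by apply: eq_bigr => k _; rewrite mulr_sumr; apply: eq_bigr => l _; rewrite mulrA.
Qed.

Lemma paw_linear a b c d :
  (paw A a b c d)%:B - (paw B a b c d)%:B <=
  (dev a b * [&& p a != p c, p b != p c, p c != p d & p a == p d]%:B
   + dev a c * [&& p a != p b, p b != p c, p c != p d & p a == p d]%:B
   + dev b c * [&& p a != p b, p a != p c, p c != p d & p a == p d]%:B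
   + dev c d * [&& p a != p b, p a != p c, p b != p c & p a == p d]%:B
   - dev a d * [&& p a != p b, p a != p c, p b != p c & p c != p d]%:B)
  + (wrong a b * wrong a c + (wrong a b + wrong a c) * wrong b c
     + (wrong a b + wrong a c + wrong b c) * wrong c d
     + (wrong a b + wrong a c + wrong b c + wrong c d) * wrong a d).
Proof.
have := prod5_linear R (A a b) (A a c) (A b c) (A c d) (~~ A a d)
  (B a b) (B a c) (B b c) (B c d) (~~ B a d).
have pawE (C : rel T) : (paw C a b c d)%:B =
    (C a b)%:B * (C a c)%:B * (C b c)%:B * (C c d)%:B * (~~ C a d)%:B.
  by rewrite -!natrM !mulnb /paw !andbA.
have -> : (~~ A a d != ~~ B a d) = (A a d != B a d) by case: (A a d); case: (B a d).
have -> : (~~ A a d)%:B - (~~ B a d)%:B = - dev a d.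
  by rewrite /dev; case: (A a d); case: (B a d); rewrite /=; ring.
rewrite -!pawE -/(dev a b) -/(dev a c) -/(dev b c) -/(dev c d).
rewrite -/(wrong a b) -/(wrong a c) -/(wrong b c) -/(wrong c d) -/(wrong a d).
move=> /(le_trans (ler_norm _)) le; rewrite -lerBlDl; apply: le_trans le.
rewrite /blow !negbK lerD2l lerN2.
case: (p a == p b); case: (p a == p c); case: (p b == p c); case: (p c == p d);
  case: (p a == p d); rewrite /=; lra.
Qed.

Let S (g : T -> T -> T -> T -> R) : R := \sum_a \sum_b \sum_c \sum_d g a b c d.

Let SD (g h : T -> T -> T -> T -> R) : S (fun a b c d => g a b c d + h a b c d) = S g + S h.
Proof. by rewrite /S; do 4! (rewrite -big_split /=; apply: eq_bigr => ? _). Qed.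

Let eqS (g h : T -> T -> T -> T -> R) :
  (forall a b c d, g a b c d = h a b c d) -> S g = S h.
Proof. by move=> E; rewrite /S; do 4! (apply: eq_bigr => ? _). Qed.

(** The adjacent transpositions [S12], [S23], [S34] generate all renamings of the four summation
    variables. *)
Let S23 (g : T -> T -> T -> T -> R) : S g = S (fun a c b d => g a b c d).
Proof. by apply: eq_bigr => a _; exact: exchange_big. Qed.

Let S12 (g : T -> T -> T -> T -> R) : S g = S (fun b a c d => g a b c d).
Proof. exact: exchange_big. Qed.

Let S34 (g : T -> T -> T -> T -> R) : S g = S (fun a b d c => g a b c d).
Proof. by apply: eq_bigr => a _; apply: eq_bigr => b _; exact: exchange_big. Qed.

(** In each of the five summands the variables are renamed so that the deviating pair is ([u], [v]);
    the other two vertices then enter through their parts only. *)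
Lemma paw_linear_sum :
  \sum_a \sum_b \sum_c \sum_d
    (dev a b * [&& p a != p c, p b != p c, p c != p d & p a == p d]%:B
   + dev a c * [&& p a != p b, p b != p c, p c != p d & p a == p d]%:B
   + dev b c * [&& p a != p b, p a != p c, p c != p d & p a == p d]%:B
   + dev c d * [&& p a != p b, p a != p c, p b != p c & p a == p d]%:B
   - dev a d * [&& p a != p b, p a != p c, p b != p c & p c != p d]%:B)
  = \sum_u \sum_v dev u v *
     \sum_k \sum_l part_size R p k * part_size R p l * paw_coef R (p u) (p v) k l.
Proof.
transitivity (S (fun u v x y => dev u v * paw_coef R (p u) (p v) (p x) (p y))).
  rewrite -/(S _) !SD.
  have -> : S (fun u v x y => dev u v * paw_coef R (p u) (p v) (p x) (p y)) =
    S (fun a b c d => dev a b * [&& p a != p c, p b != p c, p c != p d & p a == p d]%:B)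
    + S (fun u v x y => dev u v * [&& p u != p x, p x != p v, p v != p y & p u == p y]%:B)
    + S (fun u v x y => dev u v * [&& p x != p u, p x != p v, p v != p y & p x == p y]%:B)
    + S (fun u v x y => dev u v * [&& p x != p y, p x != p u, p y != p u & p x == p v]%:B)
    + S (fun u v x y => - (dev u v * [&& p u != p x, p u != p y, p x != p y & p y != p v]%:B)).
    by rewrite -!SD; apply: eqS => u v x y; rewrite /paw_coef; ring.
  congr (_ + _ + _ + _ + _).
  - by rewrite [LHS]S23.
  - by rewrite [LHS]S12 [LHS]S23.
  - by rewrite [LHS]S23 [LHS]S12 [LHS]S34 [LHS]S23.
  - by rewrite [LHS]S34 [LHS]S23.
apply: eq_bigr => u _; apply: eq_bigr => v _; rewrite -sum2_part mulr_sumr.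
by apply: eq_bigr => x _; rewrite mulr_sumr.
Qed.

Lemma wrong_sym u v : wrong u v = wrong v u.
Proof. by rewrite /wrong symA blow_sym. Qed.

Lemma wrong_ge0 u v : 0 <= wrong u v.
Proof. exact: ler0n. Qed.

(** Of the ten products of two wrong pairs, eight share a vertex and two are disjoint. In either
    case, once one wrong pair is fixed, the other two vertices contribute at most [n * h]. *)
Lemma paw_quadratic_sum h : (forall u, \sum_v wrong u v <= h) ->
  \sum_a \sum_b \sum_c \sum_d (wrong a b * wrong a c + (wrong a b + wrong a c) * wrong b c
     + (wrong a b + wrong a c + wrong b c) * wrong c d
     + (wrong a b + wrong a c + wrong b c + wrong c d) * wrong a d)
  <= 10 * (n * h * (disc A p)%:R).
Proof.
move=> row; rewrite disc_sum; set W := \sum_u \sum_v wrong u v.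
have X (g : T -> T -> T -> T -> R) :
    (forall u v, \sum_x \sum_y g u v x y <= n * h * wrong u v) -> S g <= n * h * W.
  move=> gh; rewrite /W mulr_sumr; apply: ler_sum => u _; rewrite mulr_sumr.
  by apply: ler_sum => v _.
have X1 : S (fun u v x y => wrong u v * wrong u x) <= n * h * W.
  apply: X => u v; under eq_bigr do rewrite sumr_const -mulr_natr -mulrA.
  rewrite -mulr_sumr -mulr_suml mulrC ler_wpM2r ?wrong_ge0 // mulrC.
  by rewrite ler_wpM2l ?ler0n.
have X2 : S (fun u v x y => wrong u v * wrong v x) <= n * h * W.
  by rewrite [leLHS]S12; under eqS do rewrite wrong_sym.
have X3 : S (fun u v x y => wrong u v * wrong x y) <= n * h * W.
  apply: X => u v; under eq_bigr do rewrite -mulr_sumr.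
  rewrite -mulr_sumr mulrC ler_wpM2r ?wrong_ge0 //.
  rewrite mulrC mulr_natr -sumr_const; exact: ler_sum.
rewrite [leLHS](eqS (h := fun a b c d => wrong a b * wrong a c + wrong a b * wrong b c
   + wrong a c * wrong c b + wrong a b * wrong c d + wrong a c * wrong c d
   + wrong b c * wrong c d + wrong a b * wrong a d + wrong a c * wrong a d
   + wrong b c * wrong a d + wrong c d * wrong d a)); last first.
  by move=> a b c d; rewrite (wrong_sym c b) (wrong_sym d a); ring.
rewrite !SD.
have -> : S (fun a b c d => wrong a c * wrong c b) = S (fun u v x y => wrong u v * wrong v x).
  by rewrite [LHS]S23.
have -> : S (fun a b c d => wrong a c * wrong c d) = S (fun u v x y => wrong u v * wrong v x).
  by rewrite [LHS]S23 [LHS]S34.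
have -> : S (fun a b c d => wrong b c * wrong c d) = S (fun u v x y => wrong u v * wrong v x).
  by rewrite [LHS]S12 [LHS]S23 [LHS]S34.
have -> : S (fun a b c d => wrong a b * wrong a d) = S (fun u v x y => wrong u v * wrong u x).
  by rewrite [LHS]S34.
have -> : S (fun a b c d => wrong a c * wrong a d) = S (fun u v x y => wrong u v * wrong u x).
  by rewrite [LHS]S23 [LHS]S34.
have -> : S (fun a b c d => wrong b c * wrong a d) = S (fun u v x y => wrong u v * wrong x y).
  by rewrite [LHS]S12 [LHS]S23.
have -> : S (fun a b c d => wrong c d * wrong d a) = S (fun u v x y => wrong u v * wrong v x).
  by rewrite [LHS]S23 [LHS]S12 [LHS]S34 [LHS]S23.
lra.
Qed.

(** Each of the 25 summands has a coefficient of modulus at most 5 and a product of part sizes off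
    by at most [n ^+ 2 / 12500]. *)
Lemma linear_coef_close i j :
  (forall k, `|part_size R p k - n / 5| <= n / 100 / 100) ->
  `|\sum_k \sum_l part_size R p k * part_size R p l * paw_coef R i j k l
    - (n / 5) ^+ 2 * (if i == j then - 4 else 3)| <= n ^+ 2 / 100.
Proof.
move=> bal; rewrite -(sum_paw_coef R) mulr_sumr -sumrB.
have n0 : 0 <= n by [].
have b (k l : 'I_5) : `|part_size R p k * part_size R p l * paw_coef R i j k l
    - (n / 5) ^+ 2 * paw_coef R i j k l| <= n ^+ 2 / 25 / 100.
  rewrite -mulrBl normrM.
  have c5 : `|paw_coef R i j k l| <= 5.
    have b01 (x : bool) : `|x%:B| <= 1 by rewrite ger0_norm ?ler0n // lern1 leq_b1.
    rewrite /paw_coef (_ : 5 = 1 + 1 + 1 + 1 + 1); last by ring.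
    apply: le_trans (ler_normB _ _) (lerD _ (b01 _)).
    by do 3! apply: le_trans (ler_normD _ _) (lerD _ (b01 _)).
  have pb : `|part_size R p k * part_size R p l - (n / 5) ^+ 2| <= n ^+ 2 / 125 / 100.
    apply: le_trans (mul_near _ (bal k) (bal l)) _; first by rewrite divr_ge0.
    have n2 := sqr_ge0 n.
    rewrite [leLHS](_ : _ = n ^+ 2 * ((2 / 5 + 1 / 100 / 100) / 100 / 100)); last by field.
    rewrite [leRHS](_ : _ = n ^+ 2 * (1 / 125 / 100)); last by field.
    by apply: ler_wpM2l => //; lra.
  apply: le_trans (ler_pM _ _ pb c5) _ => //.
  by rewrite le_eqVlt; apply/orP; left; apply/eqP; field.
have s25 (x : R) : \sum_(k < 5) \sum_(l < 5) x = x * 25.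
  by rewrite !big_ord_recl !big_ord0; ring.
have -> : n ^+ 2 / 100 = n ^+ 2 / 25 / 100 * 25.
  by field.
rewrite -s25.
apply: le_trans (ler_norm_sum _ _ _) _; apply: ler_sum => k _.
rewrite mulr_sumr -sumrB.
by apply: le_trans (ler_norm_sum _ _ _) _; apply: ler_sum => l _.
Qed.

(** Per wrong ordered pair the linear term loses at least [(3 / 25 - 1 / 100) * n ^+ 2], and the
    quadratic terms regain at most [n ^+ 2 / 100]. *)
Lemma homs_le_blow_small_degree :
  (forall k, `|part_size R p k - n / 5| <= n / 100 / 100) ->
  (forall u, \sum_v (A u v != B u v)%:B <= n / 10 / 100) ->
  (homs A)%:R + n ^+ 2 / 20 * (disc A p)%:R <= (homs B)%:R.
Proof.
move=> bal row; rewrite !homsE.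
have quad := paw_quadratic_sum row.
have lin : \sum_u \sum_v dev u v *
     \sum_k \sum_l part_size R p k * part_size R p l * paw_coef R (p u) (p v) k l
   <= - (n ^+ 2 * (11 / 100)) * (disc A p)%:R.
  rewrite disc_sum mulr_sumr; apply: ler_sum => u _; rewrite mulr_sumr.
  apply: ler_sum => v _; have := linear_coef_close (p u) (p v) bal.
  have := sqr_ge0 n; set K := \sum_k _.
  rewrite ler_norml /dev /wrong /blow; case: (p u == p v); case: (A u v) => /=;
    move=> n20 /andP [k1 k2]; lra.
have := paw_linear_sum; have SE g : S g = \sum_a \sum_b \sum_c \sum_d g a b c d by [].
rewrite -{1}SE => linE; rewrite -linE in lin.
have : S (fun a b c d => (paw A a b c d)%:B - (paw B a b c d)%:B) <=
   - (n ^+ 2 * (11 / 100)) * (disc A p)%:R + 10 * (n * (n / 10 / 100) * (disc A p)%:R).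
  apply: le_trans (lerD lin quad); rewrite -!SE -SD.
  by do 4! (apply: ler_sum => ? _); apply: paw_linear.
rewrite SD.
have -> : S (fun a b c d => - (paw B a b c d)%:B) = - S (fun a b c d => (paw B a b c d)%:B).
  by rewrite /S -sumrN; do 3! (apply: eq_bigr => ? _; rewrite -sumrN).
rewrite !SE; have := mulr_ge0 (sqr_ge0 n) (ler0n R (disc A p)); lra.
Qed.

End SmallDegreeDiscrepancy.

(** * Copies of the paw through one vertex *)

Section VertexPolynomial.
Variable R : realFieldType.

(** With elementary symmetric polynomials of the five densities, this is 12 e1 + 4 e2 - 6 e3. *)
Definition vertex_poly (z a b c d : R) : R :=
  12 * (z + a + b + c + d)
  + 4 * (z * (a + b + c + d) + a * (b + c + d) + b * (c + d) + c * d)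
  - 6 * (z * (a * (b + c + d) + b * (c + d) + c * d) + a * (b * (c + d) + c * d) + b * c * d).

Lemma affine_le (u v m z x : R) : z <= x <= 1 ->
  u + v * z <= m -> u + v <= m -> u + v * x <= m.
Proof.
move=> /andP [zx x1] mz m1; have [v0|v0] := lerP 0 v.
  by apply: le_trans m1; rewrite lerD2l -[leRHS]mulr1 ler_wpM2l.
by apply: le_trans mz; rewrite lerD2l ler_wnM2l // ltW.
Qed.

(* Multiaffine in the four larger coordinates, so it suffices to check their
   values [z] and [1]. *)
Lemma vertex_poly_le (z a b c d : R) : 0 <= z ->
  z <= a <= 1 -> z <= b <= 1 -> z <= c <= 1 -> z <= d <= 1 ->
  vertex_poly z a b c d <= 48 - (z + (4 - a - b - c - d)) / 2.
Proof.
move=> z0 ha hb hc hd.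
have z1 : z <= 1 by case/andP: ha => *; lra.
pose h a b c d := vertex_poly z a b c d + (z + (4 - a - b - c - d)) / 2.
suff : h a b c d <= 48 by rewrite /h; lra.
have red (k : R -> R) u v m x : (forall t, k t = u + v * t) -> z <= x <= 1 ->
    k z <= m -> k 1 <= m -> k x <= m.
  by move=> kE hx; rewrite !kE mulr1; apply: affine_le.
have ch (k : R -> R) m x : (forall t, k t = k 0 + (k 1 - k 0) * t) -> z <= x <= 1 ->
    k z <= m -> k 1 <= m -> k x <= m by move=> kE; apply: red kE.
(* At the corners [h] becomes a polynomial in [z] of degree at most three; these squares are the
   certificates from which [lra] bounds it. *)
have hz := mulr_ge0 z0 (sqr_ge0 (z - 5 / 6)); have hz' := mulr_ge0 z0 (sqr_ge0 (z - 4 / 5)).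
have hz'' := mulr_ge0 z0 (sqr_ge0 (z - 7 / 10)); have sq := sqr_ge0 (z - 5 / 6).
have sq' := sqr_ge0 (z - 39 / 50); have sq'' := sqr_ge0 (z - 7 / 10).
have sq3 := sqr_ge0 (z - 3 / 7).
have e4 a' b' c' : a' \in [:: z; 1] -> b' \in [:: z; 1] -> c' \in [:: z; 1] ->
    h a' b' c' d <= 48.
  move=> a'E b'E c'E; apply: (ch (h a' b' c')) => //.
  - by move=> t; rewrite /h /vertex_poly; field.
  - move: a'E b'E c'E; rewrite !inE => /orP [] /eqP -> /orP [] /eqP -> /orP [] /eqP ->;
      rewrite /h /vertex_poly; lra.
  - move: a'E b'E c'E; rewrite !inE => /orP [] /eqP -> /orP [] /eqP -> /orP [] /eqP ->;
      rewrite /h /vertex_poly; lra.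
have e3 a' b' : a' \in [:: z; 1] -> b' \in [:: z; 1] -> h a' b' c d <= 48.
  move=> a'E b'E; apply: (ch (fun c => h a' b' c d)) => //.
  - by move=> t; rewrite /h /vertex_poly; field.
  - by apply: (e4 a' b'); rewrite // ?inE ?eqxx ?orbT.
  - by apply: (e4 a' b'); rewrite // ?inE ?eqxx ?orbT.
have e2 a' : a' \in [:: z; 1] -> h a' b c d <= 48.
  move=> a'E; apply: (ch (fun b => h a' b c d)) => //.
  - by move=> t; rewrite /h /vertex_poly; field.
  - by apply: (e3 a'); rewrite // ?inE ?eqxx ?orbT.
  - by apply: (e3 a'); rewrite // ?inE ?eqxx ?orbT.
apply: (ch (fun a => h a b c d)) => //.
- by move=> t; rewrite /h /vertex_poly; field.
- by apply: e2; rewrite ?inE ?eqxx ?orbT.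
- by apply: e2; rewrite ?inE ?eqxx ?orbT.
Qed.

Implicit Types X N y : 'I_5 -> R.

(* The number of copies of the paw through a vertex with [X i] neighbours in the
   class [i] of size [N i]; one summand for each of the four roles of the vertex. *)
Definition vertex_count X N : R :=
  \sum_i \sum_j \sum_k
    (X i * X j * (N k - X k) * ((i != j) && (j != k) : nat)%:R
   + X i * X j * N k * ([&& i != j, j != k & i == k] : nat)%:R
   + X i * X j * X k * ((i != j) && (i == k) : nat)%:R
   + (N i - X i) * N j * X k * ([&& i != j, i != k & j != k] : nat)%:R).

Let o1 : 'I_5 := lift ord0 ord0.
Let o2 : 'I_5 := lift ord0 (lift ord0 ord0).
Let o3 : 'I_5 := lift ord0 (lift ord0 (lift ord0 ord0)).
Let o4 : 'I_5 := lift ord0 (lift ord0 (lift ord0 (lift ord0 ord0))).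

Lemma vertex_countE y : vertex_count y (fun=> 1) =
  vertex_poly (y ord0) (y o1) (y o2) (y o3) (y o4).
Proof.
have sum5 (g : 'I_5 -> R) : \sum_i g i = g ord0 + g o1 + g o2 + g o3 + g o4.
  by rewrite !big_ord_recl big_ord0 addr0 !addrA.
rewrite /vertex_count !sum5 /=.
move: (y ord0) (y o1) (y o2) (y o3) (y o4) => y0 y1 y2 y3 y4.
rewrite /vertex_poly; ring.
Qed.

(** The class [i] of least density plays the role of [z]. The subtracted quantity is half the
    l1-distance of [y] from the neighbourhood of a vertex of class [i] in the balanced blowup. *)
Lemma vertex_count_le y : (forall i, 0 <= y i <= 1) ->
  exists i, vertex_count y (fun=> 1) <= 48 - (y i + \sum_(j | j != i) (1 - y j)) / 2.
Proof.
move=> y01; have [i _ ymin] := arg_minP y (erefl : xpredT ord0).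
exists i; have le j : y i <= y j <= 1 by rewrite ymin // (andP (y01 j)).2.
rewrite big_mkcond /= !big_ord_recl big_ord0 -/o1 -/o2 -/o3 -/o4 vertex_countE.
have z0 : 0 <= y i by case/andP: (y01 i).
have : i \in [:: ord0; o1; o2; o3; o4].
  by case: i {ymin le z0} => [[|[|[|[|[]]]]]].
rewrite !inE => /or4P [/eqP E|/eqP E|/eqP E|/orP [] /eqP E].
- have := vertex_poly_le z0 (le o1) (le o2) (le o3) (le o4).
  by rewrite E /= /vertex_poly; lra.
- have := vertex_poly_le z0 (le ord0) (le o2) (le o3) (le o4).
  by rewrite E /= /vertex_poly; lra.
- have := vertex_poly_le z0 (le ord0) (le o1) (le o3) (le o4).
  by rewrite E /= /vertex_poly; lra.
- have := vertex_poly_le z0 (le ord0) (le o1) (le o2) (le o4).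
  by rewrite E /= /vertex_poly; lra.
- have := vertex_poly_le z0 (le ord0) (le o1) (le o2) (le o3).
  by rewrite E /= /vertex_poly; lra.
Qed.

Lemma vertex_count_blow t : vertex_count (fun i => (i != t : nat)%:R) (fun=> 1) = 48.
Proof.
rewrite vertex_countE.
by case: t => [[|[|[|[|[]]]]] //] ?; rewrite /= /vertex_poly; ring.
Qed.

End VertexPolynomial.

(** * Perturbation of the vertex count *)

Section VertexCountPerturbation.
Variable R : realFieldType.
Implicit Types X N y : 'I_5 -> R.

Lemma mul3_near (a b c a' b' c' e m : R) (s : bool) : 0 <= e ->
  0 <= a <= m -> 0 <= b <= m -> 0 <= c <= m ->
  0 <= a' <= m -> 0 <= b' <= m -> 0 <= c' <= m ->
  `|a - a'| <= e -> `|b - b'| <= e -> `|c - c'| <= e ->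
  `|a * b * c * (s : nat)%:R - a' * b' * c' * (s : nat)%:R| <= 3 * e * m ^+ 2.
Proof.
move=> e0 /andP [a0 am] /andP [b0 bm] /andP [c0 cm].
move=> /andP [a'0 a'm] /andP [b'0 b'm] /andP [c'0 c'm] ea eb ec.
rewrite -mulrBl normrM -[leRHS]mulr1 ler_pM //; last first.
  by rewrite ger0_norm ?ler0n // lern1 leq_b1.
have -> : a * b * c - a' * b' * c' =
  (a - a') * (b * c) + (b - b') * (a' * c) + (c - c') * (a' * b') by ring.
have bd (x u v : R) : `|x| <= e -> 0 <= u -> 0 <= v -> u <= m -> v <= m ->
    `|x * (u * v)| <= e * m ^+ 2.
  move=> xe u0 v0 um vm; rewrite normrM (ger0_norm (mulr_ge0 u0 v0)).
  by rewrite expr2 ler_pM ?mulr_ge0 // ler_pM.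
apply: le_trans (ler_normD _ _) _; apply: le_trans (lerD (ler_normD _ _) (lexx _)) _.
have := bd _ _ _ ea b0 c0 bm cm; have := bd _ _ _ eb a'0 c0 a'm cm.
have := bd _ _ _ ec a'0 b'0 a'm b'm; lra.
Qed.

(** There are 125 triples of classes with four cubic terms each; the factors, including [N i - X i],
    are off by at most [2 * e], so a term is off by at most [6 * e * m ^+ 2]. *)
Lemma vertex_count_near X N y (nu e m : R) : 0 <= e -> 0 <= nu -> nu <= m ->
  (forall i, 0 <= X i <= N i) -> (forall i, N i <= m) -> (forall i, 0 <= y i <= 1) ->
  (forall i, `|X i - nu * y i| <= e) -> (forall i, `|N i - nu| <= e) ->
  `|vertex_count X N - nu ^+ 3 * vertex_count y (fun=> 1)| <= 30 * 100 * (e * m ^+ 2).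
Proof.
move=> e0 nu0 num XN Nm y01 Xe Ne.
have yb i : 0 <= nu * y i <= m.
  case/andP: (y01 i) => y0 y1; rewrite mulr_ge0 //=; apply: le_trans num.
  by rewrite -[leRHS]mulr1 ler_wpM2l.
have zb i : 0 <= nu * (1 - y i) <= m.
  case/andP: (y01 i) => y0 y1; rewrite mulr_ge0 ?subr_ge0 //=; apply: le_trans num.
  by rewrite -[leRHS]mulr1 ler_wpM2l // lerBlDr lerDl.
have Xb i : 0 <= X i <= m by case/andP: (XN i) => x0 /le_trans /(_ (Nm i)) ->; rewrite x0.
have Nb i : 0 <= N i <= m.
  by rewrite Nm andbT; case/andP: (XN i) => x0 /(le_trans x0).
have Zb i : 0 <= N i - X i <= m.
  case/andP: (XN i) => x0 xn; rewrite subr_ge0 xn /=; have := Nm i; lra.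
have nb : 0 <= nu <= m by rewrite nu0.
have Ze i : `|N i - X i - nu * (1 - y i)| <= 2 * e.
  have -> : N i - X i - nu * (1 - y i) = (N i - nu) - (X i - nu * y i) by ring.
  by apply: le_trans (ler_normB _ _) _; have := Xe i; have := Ne i; lra.
have e2 : 0 <= 2 * e by lra.
have Xe2 i : `|X i - nu * y i| <= 2 * e by apply: le_trans (Xe i) _; lra.
have Ne2 i : `|N i - nu| <= 2 * e by apply: le_trans (Ne i) _; lra.
have s5 (x : R) : \sum_(i < 5) x = 5 * x by rewrite !big_ord_recl big_ord0; ring.
have s125 (x : R) : \sum_(i < 5) \sum_(j < 5) \sum_(k < 5) x = 125 * x.
  rewrite !s5; ring.
have -> : 30 * 100 * (e * m ^+ 2) = 125 * (24 * e * m ^+ 2) by ring.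
rewrite -s125 mulr_sumr -sumrB; apply: le_trans (ler_norm_sum _ _ _) _; apply: ler_sum => i _.
rewrite mulr_sumr -sumrB; apply: le_trans (ler_norm_sum _ _ _) _; apply: ler_sum => j _.
rewrite mulr_sumr -sumrB; apply: le_trans (ler_norm_sum _ _ _) _; apply: ler_sum => k _.
set s1 := _ && _; set s2 := [&& _, _ & _]; set s3 := _ && _; set s4 := [&& _, _ & _].
set b1 := s1%:R; set b2 := s2%:R; set b3 := s3%:R; set b4 := s4%:R.
have -> : X i * X j * (N k - X k) * b1 + X i * X j * N k * b2
   + X i * X j * X k * b3 + (N i - X i) * N j * X k * b4
   - nu ^+ 3 * (y i * y j * (1 - y k) * b1 + y i * y j * 1 * b2
     + y i * y j * y k * b3 + (1 - y i) * 1 * y k * b4)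
  = (X i * X j * (N k - X k) * b1 - nu * y i * (nu * y j) * (nu * (1 - y k)) * b1)
  + (X i * X j * N k * b2 - nu * y i * (nu * y j) * nu * b2)
  + (X i * X j * X k * b3 - nu * y i * (nu * y j) * (nu * y k) * b3)
  + ((N i - X i) * N j * X k * b4 - nu * (1 - y i) * nu * (nu * y k) * b4) by ring.
have -> : 24 * e * m ^+ 2 = 3 * (2 * e) * m ^+ 2 + 3 * (2 * e) * m ^+ 2
  + 3 * (2 * e) * m ^+ 2 + 3 * (2 * e) * m ^+ 2 by ring.
apply: le_trans (ler_normD _ _) (lerD _ _); last exact: mul3_near.
apply: le_trans (ler_normD _ _) (lerD _ _); last exact: mul3_near.
by apply: le_trans (ler_normD _ _) (lerD _ _); apply: mul3_near.
Qed.

End VertexCountPerturbation.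

(** Only the fewer than [2 * #|T|] ordered pairs containing [v] can change status. *)
Lemma disc_le_row (T : finType) (A C : rel T) (v : T) (q : T -> 'I_5) :
  (forall u w, u != v -> w != v -> A u w = C u w) ->
  (disc A q <= disc C q + 2 * #|T|)%N.
Proof.
move=> AC.
have -> : (2 * #|T| = \sum_u \sum_w ((u == v) + (w == v)))%N.
  under eq_bigr do rewrite big_split /= sum_nat_const.
  have one : (\sum_w (w == v) = 1)%N.
    by rewrite (bigD1 v) //= eqxx big1 // => w /negPf ->.
  under eq_bigr do rewrite one addnC.
  by rewrite big_split /= -big_distrr /= one sum_nat_const !muln1 mul2n -addnn.
apply: (@leq_trans (\sum_u \sum_w
    ((C u w != blow q u w) + ((u == v) + (w == v)))))%N; last first.
  by under eq_bigr do rewrite big_split /=; rewrite big_split.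
apply: leq_sum => u _; apply: leq_sum => w _; have := AC u w.
case: (u == v); case: (w == v) => /=; last by move=> ->; rewrite ?addn0.
all: by move=> _; case: (A u w); case: (C u w); case: (blow q u w).
Qed.

(** * Correcting all pairs at one vertex *)

Section VertexCorrection.
Variables (R : realFieldType) (T : finType).
Variables (A : rel T) (p : T -> 'I_5) (v : T).
Hypotheses (symA : symmetric A) (irrA : irreflexive A).
Implicit Types (a b c d u w : T) (x : pred T).

Local Notation B := (blow p).
Local Notation n := (#|T|%:R : R).
Local Notation "b %:B" := (((b : bool) : nat)%:R : R) (at level 2, left associativity, format "b %:B").

Definition correct : rel T :=
  fun u w => if (u == v) || (w == v) then B u w else A u w.

Lemma correct_sym : symmetric correct.
Proof. by move=> u w; rewrite /correct orbC (blow_sym p u w) symA. Qed.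

Lemma correct_irr : irreflexive correct.
Proof. by move=> u; rewrite /correct /blow eqxx irrA; case: ifP. Qed.

Lemma disc_correct : (disc correct p <= disc A p)%N.
Proof.
apply: leq_sum => u _; apply: leq_sum => w _; rewrite /correct.
by case: ifP => // _; rewrite eqxx.
Qed.

Let wrong u w : R := (A u w != B u w)%:B.

(** For each role of a vertex with neighbourhood [x], the pairs at that vertex are read off [x] and
    all other pairs off the blowup. Summing over the other three vertices then gives a function of
    the densities of [x] in the classes. *)
Definition role_a x b c d : bool := [&& x b, x c, ~~ x d, B b c & B c d].
Definition role_b x a c d : bool := [&& x a, x c, B a c, B c d & ~~ B a d].
Definition role_c x a b d : bool := [&& x a, x b, x d, B a b & ~~ B a d].
Definition role_d x a b c : bool := [&& ~~ x a, x c, B a b, B a c & B b c].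

(** Passing from the actual state [g] of the pairs away from the vertex to their blowup state [h]
    costs at most one wrong-pair count in each of the two indicators. *)
Let swap_le (X Y g h : bool) (w : R) : (g != h)%:B <= w ->
  (X && h)%:B - (Y && h)%:B - 2 * w <= (X && g)%:B - (Y && g)%:B.
Proof. by case: X; case: Y; case: g; case: h => /= w0; lra. Qed.

Let and2_le (g1 g2 h1 h2 : bool) :
  ((g1 && g2) != (h1 && h2))%:B <= (g1 != h1)%:B + (g2 != h2)%:B.
Proof. by case: g1; case: g2; case: h1; case: h2 => /=; lra. Qed.

Let and3_le (g1 g2 g3 h1 h2 h3 : bool) :
  ((g1 && g2 && g3) != (h1 && h2 && h3))%:B
  <= (g1 != h1)%:B + (g2 != h2)%:B + (g3 != h3)%:B.
Proof.
apply: le_trans (and2_le _ _ _ _) _; rewrite lerD2r; exact: and2_le.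
Qed.

Let wrongN u w : (~~ A u w != ~~ B u w)%:B = wrong u w.
Proof. by rewrite /wrong; case: (A u w); case: (B u w). Qed.

(** If exactly one entry is [v], only that role changes, up to errors from wrong pairs away from
    [v]. If no entry is [v], nothing changes. If several are, the penalty 3 per coincidence
    outweighs all the role differences. *)
Lemma paw_correct_le a b c d :
  (a == v)%:B * ((role_a (B v) b c d)%:B - (role_a (A v) b c d)%:B
     - 2 * (wrong b c + wrong c d))
  + (b == v)%:B * ((role_b (B v) a c d)%:B - (role_b (A v) a c d)%:B
     - 2 * (wrong a c + wrong c d + wrong a d))
  + (c == v)%:B * ((role_c (B v) a b d)%:B - (role_c (A v) a b d)%:B
     - 2 * (wrong a b + wrong a d))
  + (d == v)%:B * ((role_d (B v) a b c)%:B - (role_d (A v) a b c)%:B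
     - 2 * (wrong a b + wrong a c + wrong b c))
  - 3 * ((a == v)%:B * (b == v)%:B + (a == v)%:B * (c == v)%:B + (a == v)%:B * (d == v)%:B
      + (b == v)%:B * (c == v)%:B + (b == v)%:B * (d == v)%:B + (c == v)%:B * (d == v)%:B)
  <= (paw correct a b c d)%:B - (paw A a b c d)%:B.
Proof.
have b01 (s : bool) : 0 <= s%:B <= 1 by rewrite ler0n lern1 leq_b1.
have w0 u w : 0 <= wrong u w by apply: ler0n.
have [av|av] := eqVneq a v; have [bv|bv] := eqVneq b v;
have [cv|cv] := eqVneq c v; have [dv|dv] := eqVneq d v; rewrite /= ?mul1r ?mul0r;
try by (have := b01 (role_a (B v) b c d); have := b01 (role_a (A v) b c d);
        have := b01 (role_b (B v) a c d); have := b01 (role_b (A v) a c d);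
        have := b01 (role_c (B v) a b d); have := b01 (role_c (A v) a b d);
        have := b01 (role_d (B v) a b c); have := b01 (role_d (A v) a b c);
        have := b01 (paw correct a b c d); have := b01 (paw A a b c d);
        have := w0 a b; have := w0 a c; have := w0 b c; have := w0 c d; have := w0 a d;
        lra).
- have rE x : role_a x b c d = [&& x b, x c & ~~ x d] && (B b c && B c d).
    by rewrite /role_a !andbA.
  have E : paw correct a b c d = [&& B v b, B v c & ~~ B v d] && (A b c && A c d).
    rewrite /paw /correct av eqxx (negPf bv) (negPf cv) (negPf dv) /=.
    case: (B v b); case: (B v c); case: (B v d); case: (A b c); case: (A c d); exact: erefl.
  have E' : paw A a b c d = [&& A v b, A v c & ~~ A v d] && (A b c && A c d).
    rewrite /paw av; case: (A v b); case: (A v c); case: (A v d); case: (A b c); case: (A c d); exact: erefl.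
  rewrite !rE E E'; have := swap_le [&& B v b, B v c & ~~ B v d] [&& A v b, A v c & ~~ A v d]
    (and2_le (A b c) (A c d) (B b c) (B c d)).
  rewrite -/(wrong b c) -/(wrong c d); lra.
- have rE x : role_b x a c d = (x a && x c) && (B a c && B c d && ~~ B a d).
    by rewrite /role_b !andbA.
  have E : paw correct a b c d = (B v a && B v c) && (A a c && A c d && ~~ A a d).
    rewrite /paw /correct bv eqxx (negPf av) (negPf cv) (negPf dv) /= (blow_sym p a v).
    case: (B v a); case: (B v c); case: (A a c); case: (A c d); case: (A a d); exact: erefl.
  have E' : paw A a b c d = (A v a && A v c) && (A a c && A c d && ~~ A a d).
    rewrite /paw bv (symA a v).
    case: (A v a); case: (A v c); case: (A a c); case: (A c d); case: (A a d); exact: erefl.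
  rewrite !rE E E'; have := swap_le (B v a && B v c) (A v a && A v c)
    (and3_le (A a c) (A c d) (~~ A a d) (B a c) (B c d) (~~ B a d)).
  rewrite wrongN -/(wrong a c) -/(wrong c d); lra.
- have rE x : role_c x a b d = [&& x a, x b & x d] && (B a b && ~~ B a d).
    by rewrite /role_c !andbA.
  have E : paw correct a b c d = [&& B v a, B v b & B v d] && (A a b && ~~ A a d).
    rewrite /paw /correct cv eqxx (negPf av) (negPf bv) (negPf dv) /=.
    rewrite (blow_sym p a v) (blow_sym p b v).
    case: (B v a); case: (B v b); case: (B v d); case: (A a b); case: (A a d); exact: erefl.
  have E' : paw A a b c d = [&& A v a, A v b & A v d] && (A a b && ~~ A a d).
    rewrite /paw cv (symA a v) (symA b v).
    case: (A v a); case: (A v b); case: (A v d); case: (A a b); case: (A a d); exact: erefl.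
  rewrite !rE E E'; have := swap_le [&& B v a, B v b & B v d] [&& A v a, A v b & A v d]
    (and2_le (A a b) (~~ A a d) (B a b) (~~ B a d)).
  rewrite wrongN -/(wrong a b); lra.
- have rE x : role_d x a b c = (~~ x a && x c) && (B a b && B a c && B b c).
    by rewrite /role_d !andbA.
  have E : paw correct a b c d = (~~ B v a && B v c) && (A a b && A a c && A b c).
    rewrite /paw /correct dv eqxx (negPf av) (negPf bv) (negPf cv) /=.
    rewrite (blow_sym p a v) (blow_sym p c v).
    case: (B v a); case: (B v c); case: (A a b); case: (A a c); case: (A b c); exact: erefl.
  have E' : paw A a b c d = (~~ A v a && A v c) && (A a b && A a c && A b c).
    rewrite /paw dv (symA a v) (symA c v).
    case: (A v a); case: (A v c); case: (A a b); case: (A a c); case: (A b c); exact: erefl.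
  rewrite !rE E E'; have := swap_le (~~ B v a && B v c) (~~ A v a && A v c)
    (and3_le (A a b) (A a c) (A b c) (B a b) (B a c) (B b c)).
  rewrite -/(wrong a b) -/(wrong a c) -/(wrong b c); lra.
have -> : paw correct a b c d = paw A a b c d; last by lra.
by rewrite /paw /correct (negPf av) (negPf bv) (negPf cv) (negPf dv).
Qed.

End VertexCorrection.

(** * The gain from correcting a vertex *)

Section VertexCorrectionGain.
Variables (R : realFieldType) (T : finType).
Variables (A : rel T) (p : T -> 'I_5) (v : T).
Hypothesis symA : symmetric A.
Implicit Types (a b c d u w : T) (x : pred T).

Local Notation B := (blow p).
Local Notation n := (#|T|%:R : R).
Local Notation "b %:B" := (((b : bool) : nat)%:R : R) (at level 2, left associativity, format "b %:B").

Definition part_degree x (i : 'I_5) : R := \sum_(u | p u == i) (x u)%:B.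

Lemma sum3_by_part (f g h : T -> R) (k : 'I_5 -> 'I_5 -> 'I_5 -> R) :
  \sum_a \sum_b \sum_c f a * g b * h c * k (p a) (p b) (p c) =
  \sum_i \sum_j \sum_l (\sum_(u | p u == i) f u) * (\sum_(u | p u == j) g u)
     * (\sum_(u | p u == l) h u) * k i j l.
Proof.
transitivity (\sum_a f a * \sum_b g b * \sum_c h c * k (p a) (p b) (p c)).
  apply: eq_bigr => a _; rewrite mulr_sumr; apply: eq_bigr => b _.
  by rewrite !mulr_sumr; apply: eq_bigr => c _; rewrite !mulrA.
rewrite (sum_by_part p f (fun i => \sum_b g b * \sum_c h c * k i (p b) (p c))).
apply: eq_bigr => i _; rewrite (sum_by_part p g (fun j => \sum_c h c * k i j (p c))).
rewrite mulr_sumr; apply: eq_bigr => j _; rewrite (sum_by_part p h (k i j)).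
by rewrite mulrA [LHS]mulr_sumr; apply: eq_bigr => l _; rewrite !mulrA.
Qed.

Lemma part_degreeC x i : \sum_(u | p u == i) (~~ x u)%:B = part_size R p i - part_degree x i.
Proof.
have -> : part_size R p i = \sum_(u | p u == i) 1.
  by rewrite /part_size -sum1_card natr_sum; apply: eq_bigl => u; rewrite inE.
by rewrite /part_degree -sumrB; apply: eq_bigr => u _; case: (x u); rewrite /=; ring.
Qed.

Lemma sum_roles x :
  \sum_a \sum_b \sum_c (role_a p x a b c)%:B + \sum_a \sum_b \sum_c (role_b p x a b c)%:B
  + \sum_a \sum_b \sum_c (role_c p x a b c)%:B + \sum_a \sum_b \sum_c (role_d p x a b c)%:B
  = vertex_count (part_degree x) (part_size R p).
Proof.
have bM (s t : bool) : (s && t)%:B = s%:B * t%:B by rewrite -mulnb natrM.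
have one i : \sum_(u | p u == i) (1 : R) = part_size R p i.
  by rewrite /part_size -sum1_card natr_sum; apply: eq_bigl => u; rewrite inE.
have Ea := sum3_by_part (fun u => (x u)%:B) (fun u => (x u)%:B) (fun u => (~~ x u)%:B)
  (fun i j k => ((i != j) && (j != k))%:B).
have Eb := sum3_by_part (fun u => (x u)%:B) (fun u => (x u)%:B) (fun=> 1)
  (fun i j k => [&& i != j, j != k & i == k]%:B).
have Ec := sum3_by_part (fun u => (x u)%:B) (fun u => (x u)%:B) (fun u => (x u)%:B)
  (fun i j k => ((i != j) && (i == k))%:B).
have Ed := sum3_by_part (fun u => (~~ x u)%:B) (fun=> 1) (fun u => (x u)%:B)
  (fun i j k => [&& i != j, i != k & j != k]%:B).
transitivity (\sum_i \sum_j \sum_k part_degree x i * part_degree x j *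
      (part_size R p k - part_degree x k) * ((i != j) && (j != k))%:B
  + \sum_i \sum_j \sum_k part_degree x i * part_degree x j * part_size R p k
      * [&& i != j, j != k & i == k]%:B
  + \sum_i \sum_j \sum_k part_degree x i * part_degree x j * part_degree x k
      * ((i != j) && (i == k))%:B
  + \sum_i \sum_j \sum_k (part_size R p i - part_degree x i) * part_size R p j
      * part_degree x k * [&& i != j, i != k & j != k]%:B); last first.
  rewrite /vertex_count -!big_split; apply: eq_bigr => i _.
  by rewrite -!big_split; apply: eq_bigr => j _; rewrite -!big_split.
congr (_ + _ + _ + _).
- transitivity (\sum_a \sum_b \sum_c
      (x a)%:B * (x b)%:B * (~~ x c)%:B * ((p a != p b) && (p b != p c))%:B).
    by do 3 (apply: eq_bigr => ? _); rewrite /role_a !bM !mulrA.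
  by rewrite Ea; do 3 (apply: eq_bigr => ? _); rewrite part_degreeC.
- transitivity (\sum_a \sum_b \sum_c
      (x a)%:B * (x b)%:B * 1 * [&& p a != p b, p b != p c & p a == p c]%:B).
    by do 3 (apply: eq_bigr => ? _); rewrite /role_b !bM /blow negbK !mulrA mulr1.
  by rewrite Eb; do 3 (apply: eq_bigr => ? _); rewrite one.
- transitivity (\sum_a \sum_b \sum_c
      (x a)%:B * (x b)%:B * (x c)%:B * ((p a != p b) && (p a == p c))%:B).
    by do 3 (apply: eq_bigr => ? _); rewrite /role_c !bM /blow negbK !mulrA.
  by rewrite Ec.
- transitivity (\sum_a \sum_b \sum_c
      (~~ x a)%:B * 1 * (x c)%:B * [&& p a != p b, p a != p c & p b != p c]%:B).
    by do 3 (apply: eq_bigr => ? _); rewrite /role_d !bM mulr1 !mulrA.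
  by rewrite Ed; do 3 (apply: eq_bigr => ? _); rewrite part_degreeC one.
Qed.

Let wrong u w : R := (A u w != B u w)%:B.
Let S (g : T -> T -> T -> T -> R) : R := \sum_a \sum_b \sum_c \sum_d g a b c d.

(** Sum of [paw_correct_le] over all quadruples: ten wrong-pair terms with factor 2 give
    [20 * (n * disc)], and the six coincidences with penalty 3 give [18 * n ^+ 2]. *)
Lemma homs_correct_ge :
  (homs A)%:R + vertex_count (part_degree (B v)) (part_size R p)
   - vertex_count (part_degree (A v)) (part_size R p)
   - 20 * (n * (disc A p)%:R) - 18 * n ^+ 2 <= (homs (correct A p v))%:R.
Proof.
have DE : (disc A p)%:R = \sum_u \sum_w wrong u w.
  by rewrite natr_sum; apply: eq_bigr => u _; rewrite natr_sum.
have SD (g h : T -> T -> T -> T -> R) : S (fun a b c d => g a b c d + h a b c d) = S g + S h.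
  by rewrite /S; do 4! (rewrite -big_split /=; apply: eq_bigr => ? _).
have SN (g : T -> T -> T -> T -> R) : S (fun a b c d => - g a b c d) = - S g.
  by rewrite /S; do 4! (rewrite -sumrN; apply: eq_bigr => ? _).
have SZ k (g : T -> T -> T -> T -> R) : S (fun a b c d => k * g a b c d) = k * S g.
  by rewrite /S; do 4! (rewrite mulr_sumr; apply: eq_bigr => ? _).
have S23 (g : T -> T -> T -> T -> R) : S g = S (fun a c b d => g a b c d).
  by apply: eq_bigr => a _; exact: exchange_big.
have S12 (g : T -> T -> T -> T -> R) : S g = S (fun b a c d => g a b c d).
  exact: exchange_big.
have S34 (g : T -> T -> T -> T -> R) : S g = S (fun a b d c => g a b c d).
  by apply: eq_bigr => a _; apply: eq_bigr => b _; exact: exchange_big.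
have one : \sum_a (a == v)%:B = 1.
  by rewrite (bigD1 v) //= eqxx big1 ?addr0 // => a /negPf ->.
have S1 (g : T -> T -> T -> R) : S (fun a b c d => (a == v)%:B * g b c d) =
    \sum_b \sum_c \sum_d g b c d.
  transitivity ((\sum_a (a == v)%:B) * \sum_b \sum_c \sum_d g b c d); last first.
    by rewrite one mul1r.
  rewrite mulr_suml; apply: eq_bigr => a _; rewrite mulr_sumr.
  by apply: eq_bigr => b _; rewrite mulr_sumr; apply: eq_bigr => c _; rewrite mulr_sumr.
have S2 (g : T -> T -> T -> R) : S (fun a b c d => (b == v)%:B * g a c d) =
    \sum_b \sum_c \sum_d g b c d by rewrite [LHS]S12 [LHS]S1.
have S3 (g : T -> T -> T -> R) : S (fun a b c d => (c == v)%:B * g a b d) =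
    \sum_b \sum_c \sum_d g b c d by rewrite [LHS]S23 [LHS]S2.
have S4 (g : T -> T -> T -> R) : S (fun a b c d => (d == v)%:B * g a b c) =
    \sum_b \sum_c \sum_d g b c d by rewrite [LHS]S34 [LHS]S3.
have W12 : \sum_a \sum_b \sum_(c : T) wrong a b = n * (disc A p)%:R.
  rewrite DE mulr_sumr; apply: eq_bigr => a _; rewrite mulr_sumr.
  by apply: eq_bigr => b _; rewrite sumr_const mulr_natl.
have W13 : \sum_a \sum_(b : T) \sum_c wrong a c = n * (disc A p)%:R.
  by rewrite -W12; apply: eq_bigr => a _; exact: exchange_big.
have W23 : \sum_(a : T) \sum_b \sum_c wrong b c = n * (disc A p)%:R.
  by rewrite sumr_const DE mulr_natl.
have V1 : \sum_(a : T) \sum_(b : T) \sum_c (c == v)%:B = n ^+ 2.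
  under eq_bigr do under eq_bigr do rewrite one.
  by under eq_bigr do rewrite sumr_const; rewrite sumr_const -mulrnA -natrX.
have V2 : \sum_(a : T) \sum_b \sum_(c : T) (b == v)%:B = n ^+ 2.
  by rewrite -V1; apply: eq_bigr => a _; exact: exchange_big.
have V3 : \sum_a \sum_(b : T) \sum_(c : T) (a == v)%:B = n ^+ 2.
  by rewrite -V2; exact: exchange_big.
have le : S (fun a b c d =>
  (a == v)%:B * ((role_a p (B v) b c d)%:B - (role_a p (A v) b c d)%:B
     - 2 * (wrong b c + wrong c d))
  + (b == v)%:B * ((role_b p (B v) a c d)%:B - (role_b p (A v) a c d)%:B
     - 2 * (wrong a c + wrong c d + wrong a d))
  + (c == v)%:B * ((role_c p (B v) a b d)%:B - (role_c p (A v) a b d)%:B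
     - 2 * (wrong a b + wrong a d))
  + (d == v)%:B * ((role_d p (B v) a b c)%:B - (role_d p (A v) a b c)%:B
     - 2 * (wrong a b + wrong a c + wrong b c))
  - 3 * ((a == v)%:B * (b == v)%:B + (a == v)%:B * (c == v)%:B + (a == v)%:B * (d == v)%:B
      + (b == v)%:B * (c == v)%:B + (b == v)%:B * (d == v)%:B + (c == v)%:B * (d == v)%:B))
  <= S (fun a b c d => (paw (correct A p v) a b c d)%:B - (paw A a b c d)%:B).
  by rewrite /S; do 4! (apply: ler_sum => ? _); exact: paw_correct_le.
move: le; rewrite !SD !SN SZ !SD.
rewrite (S1 (fun b _ _ => (b == v)%:B)) (S1 (fun _ c _ => (c == v)%:B)).
rewrite (S1 (fun _ _ d => (d == v)%:B)) (S2 (fun _ c _ => (c == v)%:B)).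
rewrite (S2 (fun _ _ d => (d == v)%:B)) (S3 (fun _ _ d => (d == v)%:B)).
rewrite V1 V2 V3.
have D3 (g h k : T -> T -> T -> R) :
  \sum_a \sum_b \sum_c (g a b c - h a b c - 2 * k a b c) =
  \sum_a \sum_b \sum_c g a b c - \sum_a \sum_b \sum_c h a b c
  - 2 * \sum_a \sum_b \sum_c k a b c.
  rewrite mulr_sumr -!sumrB; apply: eq_bigr => a _.
  rewrite mulr_sumr -!sumrB; apply: eq_bigr => b _.
  by rewrite mulr_sumr -!sumrB.
have P3 (g h : T -> T -> T -> R) :
  \sum_a \sum_b \sum_c (g a b c + h a b c) =
  \sum_a \sum_b \sum_c g a b c + \sum_a \sum_b \sum_c h a b c.
  by rewrite -!big_split; apply: eq_bigr => a _; rewrite -!big_split; apply: eq_bigr => b _;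
    rewrite -!big_split.
rewrite (S1 (fun b c d => (role_a p (B v) b c d)%:B - (role_a p (A v) b c d)%:B
     - 2 * (wrong b c + wrong c d))).
rewrite (S2 (fun a c d => (role_b p (B v) a c d)%:B - (role_b p (A v) a c d)%:B
     - 2 * (wrong a c + wrong c d + wrong a d))).
rewrite (S3 (fun a b d => (role_c p (B v) a b d)%:B - (role_c p (A v) a b d)%:B
     - 2 * (wrong a b + wrong a d))).
rewrite (S4 (fun a b c => (role_d p (B v) a b c)%:B - (role_d p (A v) a b c)%:B
     - 2 * (wrong a b + wrong a c + wrong b c))).
rewrite !D3 !P3 !W12 !W13 !W23 -!sum_roles !homsE -!/(S _).
rewrite -/(S (fun a b c d => (paw (correct A p v) a b c d)%:B)).
rewrite -/(S (fun a b c d => (paw A a b c d)%:B)).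
lra.
Qed.

End VertexCorrectionGain.

(** * Balance of nearly optimal partitions *)

Section LocalStability.
Variables (R : realFieldType) (T : finType).
Implicit Types (A : rel T) (p q : T -> 'I_5) (a b c d u v w : T).

Local Notation n := (#|T|%:R : R).
Local Notation "b %:B" := (((b : bool) : nat)%:R : R) (at level 2, left associativity, format "b %:B").

Lemma homs_le_blow_disc A p :
  (homs A)%:R <= (homs (blow p))%:R + 5 * (n ^+ 2 * (disc A p)%:R).
Proof.
pose wr u v : R := (A u v != blow p u v)%:B.
have DE : (disc A p)%:R = \sum_u \sum_v wr u v.
  by rewrite natr_sum; apply: eq_bigr => u _; rewrite natr_sum.
have W34 : \sum_(a : T) \sum_(b : T) \sum_c \sum_d wr c d = n ^+ 2 * (disc A p)%:R.
  by rewrite !sumr_const -DE -[LHS]mulr_natl -[X in _ * X = _]mulr_natl mulrA expr2.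
have W24 : \sum_(a : T) \sum_b \sum_(c : T) \sum_d wr b d = n ^+ 2 * (disc A p)%:R.
  by rewrite -W34; apply: eq_bigr => a _; exact: exchange_big.
have W14 : \sum_a \sum_(b : T) \sum_(c : T) \sum_d wr a d = n ^+ 2 * (disc A p)%:R.
  by rewrite -W24; exact: exchange_big.
have W23 : \sum_(a : T) \sum_b \sum_c \sum_(d : T) wr b c = n ^+ 2 * (disc A p)%:R.
  by rewrite -W24; do 2 (apply: eq_bigr => ? _); exact: exchange_big.
have W13 : \sum_a \sum_(b : T) \sum_c \sum_(d : T) wr a c = n ^+ 2 * (disc A p)%:R.
  by rewrite -W14; do 2 (apply: eq_bigr => ? _); exact: exchange_big.
have W12 : \sum_a \sum_b \sum_(c : T) \sum_(d : T) wr a b = n ^+ 2 * (disc A p)%:R.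
  by rewrite -W13; apply: eq_bigr => ? _; exact: exchange_big.
have -> : 5 * (n ^+ 2 * (disc A p)%:R) = \sum_a \sum_b \sum_c \sum_d
    (wr a b + wr a c + wr b c + wr c d + wr a d).
  transitivity (\sum_a \sum_b \sum_(c : T) \sum_(d : T) wr a b
    + \sum_a \sum_(b : T) \sum_c \sum_(d : T) wr a c
    + \sum_(a : T) \sum_b \sum_c \sum_(d : T) wr b c
    + \sum_(a : T) \sum_(b : T) \sum_c \sum_d wr c d
    + \sum_a \sum_(b : T) \sum_(c : T) \sum_d wr a d).
    by rewrite W12 W13 W23 W34 W14; ring.
  by rewrite -!big_split; do 3 (apply: eq_bigr => ? _; rewrite -!big_split).
rewrite !homsE -big_split /=; apply: ler_sum => a _.
rewrite -big_split /=; apply: ler_sum => b _; rewrite -big_split /=; apply: ler_sum => c _.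
rewrite -big_split /=; apply: ler_sum => d _; rewrite -!natrD ler_nat /paw.
by do 5! (case: (A _ _); case: (blow p _ _) => //=).
Qed.

(** The quadratic term in [paw_poly_stability5] bounds the squared deviation of every single part
    weight by [e / (3 / 625)]. *)
Lemma parts_balanced p (e r : R) : (0 < #|T|)%N -> e < 1 / 20 / 100 -> 0 <= r ->
  e <= 3 / 625 * r ^+ 2 ->
  (12 / 125 - e) * n ^+ 4 <= (homs (blow p))%:R ->
  forall k, `|part_size R p k - n / 5| <= r * n.
Proof.
move=> n0 e1 r0 er; have nR : 0 < n by rewrite ltr0n.
rewrite homs_blow_weight // mulrC ler_pM2l ?exprn_gt0 // => large k.
have big : 12 / 125 - 1 / 2000 < paw_poly (fun i => n^-1 * part_size R p i) by lra.
have stab := paw_poly_stability5 (card_ord 5) (part_weight_ge0 R p)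
  (part_weight_sum R p n0) big.
set w := n^-1 * part_size R p k.
have wk : (w - 1 / 5) ^+ 2 <= r ^+ 2.
  move: stab; rewrite (bigD1 k) //= -/w.
  have : 0 <= \sum_(i | i != k) (n^-1 * part_size R p i - 1 / 5) ^+ 2.
    by apply: sumr_ge0 => i _; apply: sqr_ge0.
  lra.
have -> : part_size R p k - n / 5 = n * (w - 1 / 5).
  by rewrite /w; field; rewrite gt_eqF.
rewrite normrM (gtr0_norm nR) mulrC ler_pM2r //.
by rewrite -[leRHS](ger0_norm r0) -ler_sqr ?nnegrE // -!normrX !ger0_norm ?sqr_ge0.
Qed.

End LocalStability.

(** * Vertices with many wrong pairs *)

Section HomStability.
Variables (R : realFieldType) (T : finType).
Implicit Types (A : rel T) (p q : T -> 'I_5) (u v w : T).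

Local Notation n := (#|T|%:R : R).
Local Notation "b %:B" := (((b : bool) : nat)%:R : R) (at level 2, left associativity, format "b %:B").

Lemma disc_split A p v : symmetric A -> irreflexive A ->
  (disc A p = \sum_(u | u != v) \sum_(w | w != v) (A u w != blow p u w)
     + 2 * \sum_w (A v w != blow p v w))%N.
Proof.
move=> symA irrA; rewrite /disc (bigD1 v) //=.
have E : (\sum_(u | u != v) \sum_w (A u w != blow p u w) =
    \sum_(u | u != v) \sum_(w | w != v) (A u w != blow p u w)
    + \sum_w (A v w != blow p v w))%N.
  rewrite [X in (_ = _ + X)%N](bigD1 v) //= irrA /blow eqxx add0n -big_split /=.
  by apply: eq_bigr => u _; rewrite (bigD1 v) //= addnC symA (eq_sym (p u)).
by rewrite E; lia.
Qed.

(** Moving [v] to class [i] affects only the pairs at [v], so an optimal [p] has already put [v]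
    where it fits best. This allows a comparison with whichever class [vertex_count_le] returns. *)
Lemma row_disc_le A p v i : symmetric A -> irreflexive A ->
  (forall q, (disc A p <= disc A q)%N) ->
  (\sum_w (A v w != blow p v w) <= \sum_w (A v w != (i != p w)))%N.
Proof.
move=> symA irrA opt; pose q u := if u == v then i else p u.
have := opt q; rewrite (disc_split _ v symA irrA) (disc_split q v symA irrA).
have -> : (\sum_(u | u != v) \sum_(w | w != v) (A u w != blow q u w) =
  \sum_(u | u != v) \sum_(w | w != v) (A u w != blow p u w))%N.
  apply: eq_bigr => u /negPf uv; apply: eq_bigr => w /negPf wv.
  by rewrite /blow /q uv wv.
rewrite leq_add2l leq_mul2l /= => /leq_trans; apply.
apply: leq_sum => w _; rewrite /blow /q eqxx.
by have [->|//] := eqVneq w v; rewrite irrA eqxx.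
Qed.

Lemma part_degree_le p (x : pred T) k :
  0 <= part_degree R p x k <= part_size R p k.
Proof.
rewrite sumr_ge0 //= -subr_ge0 -part_degreeC sumr_ge0 //.
Qed.

(** By [vertex_count_le], [n / 1000] wrong pairs at [v] cost about [(n / 5) ^+ 2 * n / 2000], that
    is [n ^+ 3 / 50000], copies through [v]. Perturbation errors and the losses in [homs_correct_ge]
    consume less than half of this. *)
Lemma homs_correct_gain A p v : symmetric A -> irreflexive A ->
  100 ^+ 4 <= n ->
  (forall k, `|part_size R p k - n / 5| <= 1 / 100 ^+ 5 * n) ->
  (disc A p)%:R <= 1 / 100 ^+ 12 * n ^+ 2 ->
  (forall q, (disc A p <= disc A q)%N) ->
  n / 10 / 100 <= \sum_w (A v w != blow p v w)%:B ->
  (homs A)%:R + n ^+ 3 / 10 / 100 / 100 <= (homs (correct A p v))%:R.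
Proof.
move=> symA irrA nbig bal dsmall opt row.
have n0 : 0 < n by apply: lt_le_trans nbig; rewrite exprn_gt0.
apply: le_trans (homs_correct_ge R p v symA).
set N := part_size R p; pose nu := n / 5; pose e : R := 1 / 100 ^+ 5 * n.
have nu0 : 0 < nu by rewrite divr_gt0.
have e0 : 0 <= e by rewrite mulr_ge0 ?divr_ge0 ?exprn_ge0 // ltW.
have num : nu <= n by rewrite /nu; lra.
have Nm k : N k <= n.
  rewrite -(sum_part_size R p) (bigD1 k) //= lerDl; apply: sumr_ge0 => i _; exact: ler0n.
have XB k : part_degree R p (blow p v) k = N k * (k != p v)%:B.
  rewrite /part_degree mulr_natr.
  have -> : N k = \sum_(u | p u == k) 1.
    by rewrite /N /part_size -sum1_card natr_sum; apply: eq_bigl => u; rewrite inE.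
  rewrite -sumrMnl; apply: eq_bigr => u /eqP uk.
  by rewrite /blow uk eq_sym.
have nearB : `|vertex_count (part_degree R p (blow p v)) N
    - nu ^+ 3 * vertex_count (fun i => (i != p v)%:B) (fun=> 1)| <= 30 * 100 * (e * n ^+ 2).
  apply: vertex_count_near => //; [exact: ltW|exact: part_degree_le| |].
  - by move=> i; rewrite ler0n lern1 leq_b1.
  - move=> i; rewrite XB -mulrBl normrM -[leRHS]mulr1 ler_pM ?bal //.
    by rewrite ger0_norm ?ler0n // lern1 leq_b1.
(* The density is capped at 1 because a class may be slightly larger than [n / 5]; the cap costs at
   most [e]. *)
pose X := part_degree R p (A v); pose y i := Num.min 1 (X i / nu).
have X0 i : 0 <= X i by case/andP: (part_degree_le p (A v) i).
have XN i : X i <= N i by case/andP: (part_degree_le p (A v) i).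
have y01 i : 0 <= y i <= 1.
  apply/andP; split; last by rewrite /y ge_min lexx.
  by rewrite /y le_min ler01 divr_ge0 // ltW.
have yX i : nu * y i <= X i /\ X i <= nu * y i + e.
  have := bal i; rewrite ler_norml -/e -/nu -/N => /andP [b1 b2]; have := XN i.
  rewrite /y; case: (leP 1 (X i / nu)) => [le1|lt1].
    by move: le1; rewrite ler_pdivlMr // mul1r mulr1; lra.
  by rewrite mulrC divfK ?gt_eqF //; lra.
have nearA : `|vertex_count X N - nu ^+ 3 * vertex_count y (fun=> 1)| <= 30 * 100 * (e * n ^+ 2).
  apply: vertex_count_near => //; [exact: ltW|exact: part_degree_le|].
  by move=> i; rewrite ler_norml; have [] := yX i; lra.
have [i yi] := vertex_count_le y01.
have rowi : n / 10 / 100 <= X i + \sum_(j | j != i) (N j - X j).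
  apply: le_trans row _; rewrite -natr_sum.
  apply: le_trans (_ : (\sum_w (A v w != (i != p w)))%N%:R <= _).
    by rewrite ler_nat; apply: row_disc_le.
  rewrite natr_sum (partition_big p xpredT) //= (bigD1 i) //= lerD //.
    by apply: ler_sum => w /eqP ->; rewrite eqxx /=; case: (A v w).
  apply: ler_sum => j ji; rewrite -part_degreeC; apply: ler_sum => w /eqP ->.
  by rewrite (eq_sym i) ji; case: (A v w).
have D : n / 10 / 100 - 5 * e <= nu * (y i + \sum_(j | j != i) (1 - y j)).
  rewrite mulrDr mulr_sumr.
  have le1 : \sum_(j | j != i) (N j - X j) - 4 * e <= \sum_(j | j != i) nu * (1 - y j).
    have -> : 4 * e = \sum_(j | j != i) e.
      by rewrite sumr_const cardC1 card_ord mulr_natl.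
    rewrite -sumrB; apply: ler_sum => j _; have := bal j.
    rewrite ler_norml -/e -/nu -/N => /andP [_ b2]; have [] := yX j; lra.
  have [_] := yX i; lra.
set Dy := y i + _ in yi D; rewrite vertex_count_blow in nearB.
move: nearA nearB; rewrite !ler_norml => /andP [_ A2] /andP [B1 _].
have gain : nu ^+ 3 * vertex_count y (fun=> 1) <=
    nu ^+ 3 * 48 - nu ^+ 2 * (n / 10 / 100 - 5 * e) / 2.
  apply: le_trans (ler_wpM2l (exprn_ge0 3 (ltW nu0)) yi) _.
  have := ler_wpM2l (exprn_ge0 2 (ltW nu0)) D; lra.
have nn : 18 * n ^+ 2 <= n ^+ 3 / 100 / 100 / 100.
  have : n ^+ 2 * 100 ^+ 4 <= n ^+ 2 * n by rewrite ler_wpM2l ?exprn_ge0 // ltW.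
  have := exprn_gt0 2 n0; lra.
have dd : 20 * (n * (disc A p)%:R) <= 20 * (1 / 100 ^+ 12 * n ^+ 3).
  rewrite ler_wpM2l // (_ : _ * n ^+ 3 = n * (1 / 100 ^+ 12 * n ^+ 2)); last by ring.
  by rewrite ler_wpM2l // ltW.
have n3 := exprn_gt0 3 n0.
rewrite -/X; move: gain A2 B1; rewrite /nu /e; lra.
Qed.

End HomStability.

(** * Local stability and its propagation along symmetrisation *)

Section Stability.
Variables (R : realFieldType) (T : finType).
Implicit Types (A : rel T) (p q : T -> 'I_5) (u v w : T).

Local Notation n := (#|T|%:R : R).

(** Induction on [#|T| ^ 4 - homs A]. If some vertex has many wrong pairs for an optimal partition,
    it is corrected; the gain [n ^+ 3 / 100000] pays for the at most [2 * n] ordered pairs by which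
    the discrepancies differ, at [n ^+ 2 / 1000000] each. *)
Lemma local_stability A p : symmetric A -> irreflexive A -> 100 ^+ 4 <= n ->
  (disc A p)%:R <= 1 / 100 ^+ 12 * n ^+ 2 ->
  (12 / 125 - 1 / 100 ^+ 12) * n ^+ 4 <= (homs A)%:R ->
  exists q, (homs A)%:R + n ^+ 2 / 100 / 100 / 100 * (disc A q)%:R <= (homs (blow q))%:R.
Proof.
move=> symA irrA nbig; have n0 : 0 < n by apply: lt_le_trans nbig; rewrite exprn_gt0.
have T0 : (0 < #|T|)%N by rewrite -(ltr0n R).
move: {2}(#|T| ^ 4 - homs A)%N (leqnn (#|T| ^ 4 - homs A)%N) => k.
elim: k A symA irrA p => [|k IH] A symA irrA p.
  rewrite leqn0 subn_eq0 -(ler_nat R) natrX => le _ _.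
  have := le_trans le (homs_le R symA irrA); have := exprn_gt0 4 n0; lra.
move=> lek dsmall hbig.
have [p0 popt] : exists p0 : {ffun T -> 'I_5}, forall q, (disc A p0 <= disc A q)%N.
  case: (arg_minnP (P := xpredT) (i0 := [ffun u => p u]) (fun q : {ffun T -> 'I_5} => disc A q) isT) => p0 _ min.
  exists p0 => q; apply: leq_trans (min [ffun u => q u] isT) _.
  by do 2 (apply: leq_sum => ? _); rewrite /blow !ffunE.
have dsmall0 : (disc A p0)%:R <= 1 / 100 ^+ 12 * n ^+ 2.
  by apply: le_trans dsmall; rewrite ler_nat.
have bal : forall i, `|part_size R p0 i - n / 5| <= 1 / 100 ^+ 5 * n.
  (* One of the six units of loss comes from [hbig], the other five from [homs_le_blow_disc]. *)
  apply: (@parts_balanced R T p0 (6 * (1 / 100 ^+ 12))) => //.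
  - by lra.
  - by rewrite divr_ge0 ?exprn_ge0.
  - by lra.
  have := homs_le_blow_disc R A p0.
  have : n ^+ 2 * (disc A p0)%:R <= n ^+ 2 * (1 / 100 ^+ 12 * n ^+ 2).
    by rewrite ler_wpM2l ?exprn_ge0 // ltW.
  lra.
case: (boolP [forall v, \sum_w (A v w != blow p0 v w : nat)%:R <= n / 10 / 100]) => [/forallP row|].
  exists p0; apply: le_trans (homs_le_blow_small_degree symA _ row); last first.
    by move=> i; apply: le_trans (bal i) _; lra.
  rewrite lerD2l ler_wpM2r ?ler0n //; have := exprn_gt0 2 n0; lra.
rewrite negb_forall => /existsP [v]; rewrite -ltNge => /ltW row.
have gain := homs_correct_gain symA irrA nbig bal dsmall0 popt row.
have n3 := exprn_gt0 3 n0.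
have [|||q hq] := IH (correct A p0 v) (correct_sym _ _ symA) (correct_irr _ _ irrA) p0.
- have : (homs A < homs (correct A p0 v))%N by rewrite -(ltr_nat R); lra.
  have : (homs (correct A p0 v) <= #|T| ^ 4)%N.
    rewrite -(ler_nat R) natrX.
    apply: le_trans (homs_le R (correct_sym _ _ symA) (correct_irr _ _ irrA)) _.
    have := exprn_gt0 4 n0; lra.
  lia.
- by apply: le_trans dsmall0; rewrite ler_nat disc_correct.
- by apply: le_trans hbig _; lra.
exists q; apply: le_trans hq.
have le : (disc A q)%:R <= (disc (correct A p0 v) q)%:R + 2 * n.
  rewrite -natrM -natrD ler_nat; apply: (@disc_le_row _ _ _ v) => u w /negPf uv /negPf wv.
  by rewrite /correct uv wv.
have := ler_wpM2l (_ : 0 <= n ^+ 2 / 100 / 100 / 100) le.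
have n2 := exprn_gt0 2 n0.
move=> /(_ (ltac:(lra))); lra.
Qed.

(** Bootstrapping: undoing a merge adds at most [2 * n] to half the radius of [local_stability], so
    that lemma still applies. Since [homs] never exceeds [12 / 125 * n ^+ 4], it returns a partition
    with discrepancy below half the radius again, and errors do not accumulate. *)
Lemma closeness A : symmetric A -> irreflexive A -> 100 ^+ 13 <= n ->
  (12 / 125 - 1 / 100 ^+ 16) * n ^+ 4 <= (homs A)%:R ->
  exists p, (disc A p)%:R <= 1 / 100 ^+ 12 / 2 * n ^+ 2.
Proof.
move=> symA irrA nbig; have n0 : 0 < n by apply: lt_le_trans nbig; rewrite exprn_gt0.
have T0 : (0 < #|T|)%N by rewrite -(ltr0n R).
have n4 := exprn_gt0 4 n0; have n2 := exprn_gt0 2 n0.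
move: A symA irrA; apply: merge_ind => [A symA irrA mA hbig|A x y symA irrA].
  have [|p dp] := multipartite_close symA irrA mA T0 _ hbig; first by lra.
  by exists p; apply: le_trans dp _; lra.
rewrite -(ler_nat R) => mono IH hbig; have [|p dp] := IH; first exact: le_trans mono.
have dA : (disc A p)%:R <= 1 / 100 ^+ 12 * n ^+ 2.
  have : (disc A p)%:R <= (disc (merge A x y) p)%:R + 2 * n.
    rewrite -natrM -natrD ler_nat; apply: (@disc_le_row _ _ _ y) => u w /negPf uv /negPf wv.
    by rewrite /merge /redirect uv wv.
  have : 100 ^+ 13 * n <= n * n by rewrite ler_wpM2r // ltW.
  lra.
have [||q hq] := local_stability symA irrA _ dA; [by lra|by lra|].
exists q; have irrq : irreflexive (blow q) by move=> u; rewrite /blow eqxx.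
have hb := homs_le R (blow_sym q) irrq.
have : n ^+ 2 / 100 / 100 / 100 * (disc A q)%:R <=
    n ^+ 2 / 100 / 100 / 100 * (1 / 100 ^+ 12 / 2 * n ^+ 2) by lra.
by rewrite ler_pM2l //; lra.
Qed.

Lemma hom_stability A : symmetric A -> irreflexive A -> 100 ^+ 13 <= n ->
  (12 / 125 - 1 / 100 ^+ 16) * n ^+ 4 <= (homs A)%:R ->
  exists p, (homs A)%:R + n ^+ 2 / 100 / 100 / 100 * (disc A p)%:R <= (homs (blow p))%:R.
Proof.
move=> symA irrA nbig hbig; have [p dp] := closeness symA irrA nbig hbig.
have n0 : 0 < n by apply: lt_le_trans nbig; rewrite exprn_gt0.
have n4 := exprn_gt0 4 n0; have n2 := exprn_gt0 2 n0.
by apply: (local_stability (p := p) symA irrA); lra.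
Qed.

End Stability.

(** * From homomorphisms to embeddings *)

Section EmbeddingCounts.
Variable T : finType.
Implicit Types (A : rel T) (G : sgraph T) (a b c d u v : T).

Lemma adj_sym G : symmetric (adj G).
Proof. by move=> u v; rewrite /adj setUC. Qed.

Lemma adj_irr G : irreflexive (adj G).
Proof.
move=> u; apply/negP => uu; have := forall_inP (edges_card2 G) _ uu.
by rewrite setUid cards1.
Qed.

Lemma set2_eq u v a b : [set u; v] = [set a; b] ->
  (u = a /\ v = b) \/ (u = b /\ v = a).
Proof.
move=> E; have : u \in [set a; b] by rewrite -E set21.
have : v \in [set a; b] by rewrite -E set22.
have : a \in [set u; v] by rewrite E set21.
have : b \in [set u; v] by rewrite E set22.
rewrite !inE => /orP [] /eqP -> /orP [] /eqP -> /orP [] /eqP e1 /orP [] /eqP e2; subst; auto.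
Qed.

Lemma adj_complete (m : nat) (i j : 'I_m) : adj (complete_graph m) i j = (i != j).
Proof. by rewrite /adj inE cards2; case: (i != j). Qed.

Lemma adj_blowup (m : nat) (p : {ffun T -> 'I_m}) :
  adj (blowup (complete_graph m) p) =2 blow p.
Proof.
move=> u v; rewrite /blow; apply/idP/idP.
  rewrite {1}/adj inE => /existsP [x /existsP [y /andP [/eqP E]]].
  by rewrite adj_complete; case: (set2_eq E) => [[-> ->]|[-> ->]] //; rewrite eq_sym.
move=> uv; rewrite /adj inE; apply/existsP; exists u; apply/existsP; exists v.
by rewrite eqxx adj_complete.
Qed.

Definition embs A : nat := (\sum_a \sum_b \sum_c \sum_d (paw A a b c d && (a != d)))%N.

Definition triangles A : nat := (\sum_a \sum_b \sum_c [&& A a b, A a c & A b c])%N.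

(** The homomorphisms with [a = d] are exactly the ordered triangles. *)
Lemma homs_embs A : symmetric A -> irreflexive A -> (homs A = embs A + triangles A)%N.
Proof.
move=> symA irrA; rewrite /homs /embs /triangles -big_split; apply: eq_bigr => a _.
rewrite -big_split; apply: eq_bigr => b _; rewrite -big_split; apply: eq_bigr => c _ /=.
rewrite (bigD1 a) //= [in RHS](bigD1 a) //= eqxx andbF add0n addnC; congr addn.
  by apply: eq_bigr => d da; rewrite eq_sym da andbT.
rewrite /paw irrA andbT (symA c a).
by case: (A a b); case: (A a c); case: (A b c).
Qed.

Lemma eq_embs A B : A =2 B -> embs A = embs B.
Proof. by move=> E; do 4! (apply: eq_bigr => ? _); rewrite /paw !E. Qed.

End EmbeddingCounts.

Section EmbeddingEnumeration.
Variable T : finType.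
Implicit Types (A : rel T) (G : sgraph T) (a b c d u v : T).

(** Transfer to the vertex set ['I_#|T|], over which [max_density] is taken. *)
Lemma embs_enum A : embs A =
  embs (fun i j : 'I_#|T| => A (enum_val i) (enum_val j)).
Proof.
have R (F : T -> nat) : (\sum_a F a = \sum_(i < #|T|) F (enum_val i))%N.
  by apply: reindex; apply: onW_bij; apply: enum_val_bij.
rewrite /embs R; apply: eq_bigr => i _; rewrite R; apply: eq_bigr => j _.
rewrite R; apply: eq_bigr => k _; rewrite R; apply: eq_bigr => l _.
by rewrite (inj_eq enum_val_inj).
Qed.

Lemma sum_ffun4 (F : T -> T -> T -> T -> nat) :
  (\sum_(f : {ffun 'I_4 -> T}) F (f (inord 0)) (f (inord 1)) (f (inord 2)) (f (inord 3))
   = \sum_a \sum_b \sum_c \sum_d F a b c d)%N.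
Proof.
rewrite !pair_big /=.
pose h (t : T * T * T * T) : {ffun 'I_4 -> T} :=
  [ffun i : 'I_4 => tnth [tuple t.1.1.1; t.1.1.2; t.1.2; t.2] i].
pose g (f : {ffun 'I_4 -> T}) := (f (inord 0), f (inord 1), f (inord 2), f (inord 3)).
have hE t k (k4 : (k < 4)%N) : h t (inord k) = nth t.1.1.1 [:: t.1.1.1; t.1.1.2; t.1.2; t.2] k.
  by rewrite /h ffunE (tnth_nth t.1.1.1) /= inordK.
rewrite (reindex h) /=.
  by apply: eq_bigr => t _; rewrite !hE.
exists g => [t _|f _]; first by case: t => [[[a b] c] d]; rewrite /g !hE.
apply/ffunP => i; rewrite -(inord_val i) hE //.
by case: i => [[|[|[|[|]]]]].
Qed.

Lemma num_embeddingsE G : num_embeddings paw_blue G = embs (adj G).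
Proof.
rewrite /num_embeddings /embs -sum1_card -sum_ffun4 big_mkcond /=.
apply: eq_bigr => f _; rewrite inE /paw.
set f0 := f (inord 0); set f1 := f (inord 1); set f2 := f (inord 2); set f3 := f (inord 3).
have -> : is_embedding paw_blue G f =
    [&& adj G f0 f1, adj G f0 f2, adj G f1 f2, adj G f2 f3 & ~~ adj G f0 f3] && (f0 != f3).
  2: by case: (_ && _).
apply/idP/idP.
  case/and3P => /injectiveP inj /forallP hr /forallP hb.
  have r i j : [set inord i; inord j] \in paw_red_edges -> adj G (f (inord i)) (f (inord j)).
    by move=> ij; have /forallP /(_ (inord j)) /implyP := hr (inord i); apply.
  rewrite /f0 /f1 /f2 /f3 (r 0 1)%N ?inE ?eqxx ?orbT //.
  rewrite (r 0 2)%N ?inE ?eqxx ?orbT // (r 1 2)%N ?inE ?eqxx ?orbT //.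
  rewrite (r 2 3)%N ?inE ?eqxx ?orbT //=.
  have /forallP /(_ (inord 3)) /implyP -> := hb (inord 0); last by rewrite /adj inE.
  by apply/eqP => /inj /(congr1 val); rewrite /= !inordK.
case/andP => /and5P [a01 a02 a12 a23 na03] n03.
have ne (x y : T) : adj G x y -> x != y.
  by apply: contraTneq => ->; rewrite adj_irr.
(* The one pair besides {0,3} without a red edge: vertex 0 is adjacent to 1 but not to 3. *)
have n13 : f1 != f3 by apply: contraNneq na03 => <-.
have o4 (i : 'I_4) : [\/ i = inord 0, i = inord 1, i = inord 2 | i = inord 3].
  by rewrite -(inord_val i); case: i => [[|[|[|[|]]]]] //= _;
    [apply: Or41|apply: Or42|apply: Or43|apply: Or44].
apply/and3P; split.
- have := ne _ _ a01; have := ne _ _ a02; have := ne _ _ a12; have := ne _ _ a23.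
  move=> /eqP n23 /eqP n12 /eqP n02 /eqP n01; move/eqP: n03 n13 => n03 /eqP n13.
  apply/injectiveP => i j; case: (o4 i) => ->; case: (o4 j) => -> //;
    rewrite -/f0 -/f1 -/f2 -/f3 => E; congruence.
- apply/forallP => i; apply/forallP => j; apply/implyP.
  rewrite {1}/adj !inE => /orP [/orP [/orP [/eqP E|/eqP E]|/eqP E]|/eqP E];
    case: (set2_eq E) => [[-> ->]|[-> ->]] //; by rewrite adj_sym.
- apply/forallP => i; apply/forallP => j; apply/implyP.
  rewrite {1}/adj !inE => /eqP E.
  by case: (set2_eq E) => [[-> ->]|[-> ->]] //; rewrite adj_sym.
Qed.

End EmbeddingEnumeration.

(** * Edit distance and triangle counts *)

Section EditDistanceBound.
Variable T : finType.
Implicit Types (A : rel T) (G : sgraph T) (u v : T).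

Lemma triangles_le A (p : T -> 'I_5) :
  (triangles (blow p) <= triangles A + 3 * (#|T| * disc A p))%N.
Proof.
pose wr u v : nat := (A u v != blow p u v).
have W23 : (\sum_(a : T) \sum_b \sum_c wr b c = #|T| * disc A p)%N by rewrite sum_nat_const.
have W13 : (\sum_a \sum_(b : T) \sum_c wr a c = #|T| * disc A p)%N.
  by rewrite -W23; exact: exchange_big.
have W12 : (\sum_a \sum_b \sum_(c : T) wr a b = #|T| * disc A p)%N.
  by rewrite -W13; apply: eq_bigr => a _; exact: exchange_big.
have -> : (3 * (#|T| * disc A p) = \sum_a \sum_b \sum_c (wr a b + wr a c + wr b c))%N.
  transitivity (\sum_a \sum_b \sum_(c : T) wr a b + \sum_a \sum_(b : T) \sum_c wr a c
    + \sum_(a : T) \sum_b \sum_c wr b c)%N; first by rewrite W12 W13 W23; lia.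
  by rewrite -!big_split; do 2 (apply: eq_bigr => ? _; rewrite -!big_split).
rewrite /triangles -big_split /=; apply: leq_sum => a _.
rewrite -big_split /=; apply: leq_sum => b _; rewrite -big_split /=; apply: leq_sum => c _.
rewrite /wr; case: (A a b); case: (A a c); case: (A b c);
  by case: (blow p a b); case: (blow p a c); case: (blow p b c).
Qed.

Lemma triangles_bound A : (triangles A <= #|T| ^ 3)%N.
Proof.
have sb (g : T -> nat) m : (forall u, g u <= m)%N -> (\sum_u g u <= #|T| * m)%N.
  by move=> gm; rewrite -sum_nat_const; apply: leq_sum => u _.
rewrite expnS expnS expn1; apply: (sb) => a; apply: (sb) => b.
by rewrite -[X in (_ <= X)%N]muln1; apply: sb => c; apply: leq_b1.
Qed.

(** The identity permutation is a competitor, and each edited edge is the image of a wrong ordered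
    pair. *)
Lemma edit_dist_le G (p : {ffun T -> 'I_5}) :
  (edit_dist G (blowup (complete_graph 5) p) <= disc (adj G) p)%N.
Proof.
set G' := blowup _ _.
pose W := [set uv : T * T | adj G uv.1 uv.2 != blow p uv.1 uv.2].
have -> : disc (adj G) p = #|W|.
  rewrite /disc pair_big /= -sum1_card [RHS]big_mkcond /=; apply: eq_bigr => uv _.
  by rewrite inE; case: (_ != _).
rewrite /edit_dist; case: arg_minnP => // s _ min; apply: leq_trans (min 1%g isT) _.
rewrite /edit_cost.
have -> : [set [set (1%g : {perm T}) x | x in (e : {set T})] | e in edges G] = edges G.
  have idE (e : {set T}) : [set (1%g : {perm T}) x | x in e] = e.
    by rewrite (eq_imset _ (@perm1 T)) imset_id.
  by rewrite (eq_imset _ idE) imset_id.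
apply: leq_trans (leq_imset_card (fun uv : T * T => [set uv.1; uv.2]) W).
apply: subset_leq_card; apply/subsetP => e eD.
have e2 : #|e| == 2.
  move: eD; rewrite in_setU !in_setD => /orP [] /andP [_].
    exact: (forall_inP (edges_card2 G)).
  exact: (forall_inP (edges_card2 G')).
have /cards2P [x [y [xy E]]] := e2.
apply/imsetP; exists (x, y) => //=; rewrite inE /= -adj_blowup.
move: eD; rewrite E !in_setU !in_setD -/(adj G x y) -/(adj G' x y).
by case: (adj G x y); case: (adj G' x y).
Qed.

End EditDistanceBound.

Section EmbeddingStability.
Variables (R : realFieldType) (T : finType).
Implicit Types (A : rel T).

Local Notation n := (#|T|%:R : R).

(** The triangle counts of [A] and the blowup contribute a loss of at most [3 * n] per wrong pair,
    less than half of the gain of order [n ^+ 2] from [hom_stability]. *)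
Lemma embs_stability A : symmetric A -> irreflexive A -> 100 ^+ 13 <= n ->
  (12 / 125 - 1 / 100 ^+ 16) * n ^+ 4 <= (homs A)%:R ->
  exists p : T -> 'I_5, (embs A)%:R + n ^+ 2 / 100 / 100 / 100 / 2 * (disc A p)%:R
    <= (embs (blow p))%:R.
Proof.
move=> symA irrA nbig hbig; have [p] := hom_stability symA irrA nbig hbig.
have irrp : irreflexive (blow p) by move=> u; rewrite /blow eqxx.
rewrite (homs_embs symA irrA) (homs_embs (blow_sym p) irrp) !natrD => le.
exists p; have : ((triangles (blow p))%:R : R) <= (triangles A)%:R + 3 * (n * (disc A p)%:R).
  by rewrite -!natrM -natrD ler_nat triangles_le.
have n0 : 0 < n by apply: lt_le_trans nbig; rewrite exprn_gt0.
have : 3 * (n * (disc A p)%:R) <= n ^+ 2 / 100 / 100 / 100 / 2 * (disc A p)%:R.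
  rewrite mulrA ler_wpM2r ?ler0n //.
  have : 100 ^+ 13 * n <= n * n by rewrite ler_wpM2r // ltW.
  lra.
lra.
Qed.

End EmbeddingStability.

From mathcomp Require Import all_classical all_reals all_analysis.
Import numFieldNormedType.Exports.
Local Open Scope classical_set_scope.
Local Open Scope ring_scope.

(** * Realising prescribed part sizes *)

Section GreedyColouring.
Variables (R : realType) (a : 'I_5 -> R).
Hypotheses (a0 : forall i, 0 <= a i) (a1 : \sum_i a i = 1).

Let deficit (cnt : 'I_5 -> nat) (k : nat) (i : 'I_5) : R := k%:R * a i - (cnt i)%:R.

Let neediest (cnt : 'I_5 -> nat) (k : nat) : 'I_5 :=
  [arg max_(i > ord0) deficit cnt k.+1 i]%O.

(** One infinite colouring serves all orders: vertex [k] joins the class furthest below its target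
    [k.+1 * a i]. *)
Fixpoint greedy_count (k : nat) : 'I_5 -> nat :=
  if k is k'.+1 then
    fun i => (greedy_count k' i + (neediest (greedy_count k') k' == i))%N
  else fun=> 0%N.

Definition greedy_colour (k : nat) : 'I_5 := neediest (greedy_count k) k.

Lemma card_greedy_colour n i :
  #|[set k : 'I_n | greedy_colour k == i]%SET| = greedy_count n i.
Proof.
rewrite -sum1_card big_mkcond /= (eq_bigr (fun k : 'I_n => nat_of_bool (greedy_colour k == i))).
  by elim: n => [|n IH]; rewrite ?big_ord0 // big_ord_recr /= IH.
by move=> k _; rewrite inE; case: (_ == _).
Qed.

Lemma deficit_sum n : \sum_i deficit (greedy_count n) n i = 0.
Proof.
rewrite /deficit sumrB -mulr_sumr a1 mulr1 -natr_sum.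
have -> : (\sum_i greedy_count n i = n)%N.
  elim: n => [|n IH] /=; first by rewrite big1.
  rewrite big_split /= IH (bigD1 (neediest (greedy_count n) n)) //= eqxx big1 ?addn1 //.
  by move=> i; rewrite eq_sym => /negPf ->.
by rewrite subrr.
Qed.

Lemma deficit_ge n i : -1 <= deficit (greedy_count n) n i.
Proof.
elim: n i => [|n IH] i; first by rewrite /deficit /= mul0r subrr lerN10.
have S : \sum_j deficit (greedy_count n) n.+1 j = 1.
  transitivity (\sum_j (deficit (greedy_count n) n j + a j)).
    by apply: eq_bigr => j _; rewrite /deficit -natr1; ring.
  by rewrite big_split /= deficit_sum a1 add0r.
have step : deficit (greedy_count n.+1) n.+1 i =
    deficit (greedy_count n) n.+1 i - (neediest (greedy_count n) n == i)%:R.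
  by rewrite /deficit /= natrD; ring.
rewrite step; case: (eqVneq (neediest (greedy_count n) n) i) => [<-|_]; last first.
  rewrite subr0; apply: le_trans (IH i) _; rewrite /deficit -natr1.
  by rewrite mulrDl mul1r lerD2r lerDl.
rewrite lerBrDr addrC subrr /neediest.
case: Order.TotalTheory.arg_maxP => // j _ jmax.
(* Before the placement the five deficits sum to 1, so the largest is at least 1/5 and stays above
   -1 afterwards. *)
have : 1 <= 5 * deficit (greedy_count n) n.+1 j.
  apply: le_trans (_ : \sum_k deficit (greedy_count n) n.+1 k <= _); first by rewrite S.
  have -> : 5 * deficit (greedy_count n) n.+1 j =
    \sum_(k < 5) deficit (greedy_count n) n.+1 j by rewrite sumr_const card_ord mulr_natl.
  by apply: ler_sum => k _; apply: jmax.
by rewrite /= => le; lra.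
Qed.

(** The deficits sum to 0 and none is below -1, so none exceeds 4. *)
Lemma greedy_count_near n i : `|(greedy_count n i)%:R - n%:R * a i| <= 4.
Proof.
have ge := deficit_ge n; have := deficit_sum n; rewrite (bigD1 i) //=.
have : - 4 <= \sum_(j | j != i) deficit (greedy_count n) n j.
  have -> : - 4 = \sum_(j | j != i) (-1 : R) by rewrite sumr_const cardC1 card_ord mulNrn.
  exact: ler_sum.
have := ge i; rewrite ler_norml /deficit => g1 g2 g3; apply/andP; split; lra.
Qed.

End GreedyColouring.

(** * Limits of falling factorials *)

Section Limits.
Variable R : realType.

Lemma cvg_invn : (n%:R^-1 : R) @[n --> \oo] --> (0 : R).
Proof. by rewrite -cvg_shiftS; exact: cvg_harmonic. Qed.

Lemma ffact4_le (n : nat) : ((n ^_ 4)%:R : R) <= n%:R ^+ 4.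
Proof. by rewrite -natrX ler_nat !ffactnS ffactn0 !expnS expn0 !leq_mul // -?subn1; lia. Qed.

(** Here 6 = 1 + 2 + 3 is the coefficient of the cubic term in the falling factorial. *)
Lemma ffact4_ge (n : nat) : (n%:R : R) ^+ 4 <= (n ^_ 4)%:R + 6 * n%:R ^+ 3.
Proof.
rewrite -!natrX -natrM -natrD ler_nat.
case: n => [|[|[|[|n]]]] //; rewrite !ffactnS ffactn0 /=; nia.
Qed.

Lemma cvg_ffact4 : (n%:R ^+ 4 / (n ^_ 4)%:R : R) @[n --> \oo] --> (1 : R).
Proof.
have r1 : ((n ^_ 4)%:R / n%:R ^+ 4 : R) @[n --> \oo] --> (1 : R).
  have l1 : (1 - 6 * n%:R^-1 : R) @[n --> \oo] --> (1 : R).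
    rewrite -[X in _ --> X]subr0 -[X in _ - X](mulr0 6).
    by apply: cvgB; [exact: cvg_cst|apply: cvgM; [exact: cvg_cst|exact: cvg_invn]].
  apply: squeeze_cvgr l1 (@cvg_cst _ _ _ _ _); near=> n.
  have n0 : 0 < n%:R :> R by rewrite ltr0n; near: n; exact: nbhs_infty_gt.
  have n4 : 0 < n%:R ^+ 4 :> R by rewrite exprn_gt0.
  rewrite ler_pdivlMr // ler_pdivrMr // mul1r ffact4_le andbT.
  rewrite mulrBl mul1r lerBlDr; apply: le_trans (ffact4_ge n) _; rewrite lerD2l.
  rewrite [leRHS](_ : _ = 6 * n%:R ^+ 3) //.
  by field; rewrite gt_eqF.
rewrite -[X in _ --> X]invr1.
under eq_fun do rewrite -invf_div.
by apply: cvgV; first exact: oner_neq0.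
Unshelve. all: by end_near.
Qed.

End Limits.

(** * Densities of blowups in the limit *)

Section BlowupLimit.
Variable R : realType.

Lemma density_paw (T : finType) (G : sgraph T) :
  density R paw_blue G = (embs (adj G))%:R / (#|T| ^_ 4)%:R.
Proof. by rewrite /density num_embeddingsE card_ord. Qed.

Lemma density_paw_blowup (T : finType) (p : {ffun T -> 'I_5}) :
  density R paw_blue (blowup (complete_graph 5) p) =
  (embs (blow p))%:R / (#|T| ^_ 4)%:R.
Proof. by rewrite density_paw (eq_embs (adj_blowup p)). Qed.

Lemma max_density_ge (n : nat) (G : sgraph 'I_n) :
  density R paw_blue G <= max_density R paw_blue n.
Proof. exact: (le_bigmax 0 (fun G : sgraph 'I_n => density R paw_blue G) G). Qed.

Lemma max_density_ge_blow (T : finType) (p : T -> 'I_5) :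
  (embs (blow p))%:R / (#|T| ^_ 4)%:R <= max_density R paw_blue #|T|.
Proof.
pose q : {ffun 'I_#|T| -> 'I_5} := [ffun i => p (enum_val i)].
apply: le_trans (max_density_ge (blowup (complete_graph 5) q)).
rewrite density_paw_blowup card_ord embs_enum.
by rewrite (eq_embs (B := blow q)) // => i j; rewrite /blow !ffunE.
Qed.

Lemma embs_le (T : finType) (A : rel T) : symmetric A -> irreflexive A ->
  (embs A)%:R <= 12 / 125 * #|T|%:R ^+ 4 :> R.
Proof.
move=> symA irrA; apply: le_trans (homs_le R symA irrA).
by rewrite ler_nat (homs_embs symA irrA) leq_addr.
Qed.

Lemma cvg_paw_poly (w : nat -> 'I_5 -> R) (l : 'I_5 -> R) :
  (forall i, w n i @[n --> \oo] --> l i) ->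
  paw_poly (w n) @[n --> \oo] --> paw_poly l.
Proof.
move=> wl.
have sq (f : nat -> R) (x : R) : f n @[n --> \oo] --> x -> f n ^+ 2 @[n --> \oo] --> x ^+ 2.
  by move=> fx; rewrite expr2; under eq_fun do rewrite expr2; apply: cvgM.
have cvS (f : nat -> 'I_5 -> R) (x : 'I_5 -> R) : (forall i, f n i @[n --> \oo] --> x i) ->
    \sum_i f n i @[n --> \oo] --> \sum_i x i.
  move=> fx; apply: (@cvg_big R _ +%R 0 xpredT add_continuous _ \oo _ (fun i n => f n i)).
  by move=> i _; apply: fx.
apply: (cvS) => i; apply: cvgM; first exact: sq.
apply: cvgB; first by apply: (sq); apply: cvgB; [exact: (cvS w l wl)|exact: wl].
by apply: cvgB; [apply: cvS => j; apply: sq|apply: sq].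
Qed.

(** Embeddings are homomorphisms minus triangles, and the triangles, at most [n ^+ 3] in number,
    vanish after division by [n ^+ 4]. *)
Lemma cvg_density_blowup (a : 'rV[R]_5) (p : forall n, {ffun 'I_n -> 'I_5}) :
  part_sizes_cvg a p ->
  density R paw_blue (blowup (complete_graph 5) (p n)) @[n --> \oo] -->
  paw_poly (fun i => a ord0 i).
Proof.
move=> pa; pose w n i : R := n%:R^-1 * part_size R (p n) i.
have wl i : w n i @[n --> \oo] --> a ord0 i.
  have E n : w n i = #|p n @^-1: [set i]%SET|%:R / n%:R.
    have cE : #|[set u | p n u == i]%SET| = #|p n @^-1: [set i]%SET|.
      by apply: eq_card => u; rewrite !inE.
    by rewrite /w /part_size cE mulrC.
  by under eq_fun do rewrite E; exact: pa.
pose t n : R := (triangles (blow (p n)))%:R / n%:R ^+ 4.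
have t0 : t n @[n --> \oo] --> (0 : R).
  have c0 : (0 : R) @[n --> \oo] --> (0 : R) by exact: cvg_cst.
  apply: (@squeeze_cvgr nat \oo _ R (fun=> 0) (fun n => n%:R^-1) t _ 0 c0 (@cvg_invn R)); near=> n.
  have n0 : 0 < n%:R :> R by rewrite ltr0n; near: n; exact: nbhs_infty_gt.
  rewrite /t divr_ge0 ?exprn_ge0 //= ler_pdivrMr ?exprn_gt0 //.
  rewrite [leRHS](_ : _ = n%:R ^+ 3); last by field; rewrite gt_eqF.
  rewrite -natrX ler_nat; apply: leq_trans (triangles_bound _) _.
  by rewrite card_ord.
have lim := cvgM (@cvg_ffact4 R) (cvgB (cvg_paw_poly wl) t0).
rewrite mul1r subr0 in lim.
suff dE n : density R paw_blue (blowup (complete_graph 5) (p n)) =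
    n%:R ^+ 4 / (n ^_ 4)%:R * (paw_poly (w n) - t n).
  by under eq_fun do rewrite dE; exact: lim.
(* The identity is needed at every [n]; at 0 both sides are 0. *)
case: n => [|n0']; first by rewrite density_paw_blowup /embs big_ord0 expr0n /= !mul0r.
move: n0'.+1 (ltr0Sn R n0') => n n0 {n0'}.
have irrp : irreflexive (blow (p n)) by move=> u; rewrite /blow eqxx.
rewrite density_paw_blowup card_ord /t.
have E := homs_blow_weight R (p n); rewrite card_ord -(ltr0n R) in E.
have : (embs (blow (p n)))%:R = (homs (blow (p n)))%:R - (triangles (blow (p n)))%:R :> R.
  by rewrite (homs_embs (blow_sym (p n)) irrp) natrD addrK.
move=> ->; rewrite (E n0) /w.
set P := paw_poly _; set F := (n ^_ 4)%:R^-1; set Q := (triangles _)%:R.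
by field; rewrite gt_eqF.
Unshelve. all: by end_near.
Qed.

(** Without a sequence of this kind every real would satisfy the predicate under [get] in
    [blowup_density]; its existence makes the limit unique. *)
Lemma blowup_sequence (a : 'rV[R]_5) : simplex a ->
  exists p : forall n, {ffun 'I_n -> 'I_5}, part_sizes_cvg a p.
Proof.
move=> [a0 a1]; exists (fun n => [ffun k : 'I_n => greedy_colour (fun i => a ord0 i) k]) => i.
have l1 (c : R) : (a ord0 i + c * n%:R^-1 : R) @[n --> \oo] --> a ord0 i.
  rewrite -[X in _ --> X]addr0 -[X in _ + X](mulr0 c).
  by apply: cvgD; [exact: cvg_cst|apply: cvgM; [exact: cvg_cst|exact: cvg_invn]].
apply: squeeze_cvgr (l1 (- 4)) (l1 4); near=> n.
have n0 : 0 < n%:R :> R by rewrite ltr0n; near: n; exact: nbhs_infty_gt.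
have := greedy_count_near a0 a1 n i; rewrite -card_greedy_colour.
have -> : #|[ffun k : 'I_n => greedy_colour (fun i => a ord0 i) k] @^-1: [set i]%SET| =
    #|[set k : 'I_n | greedy_colour (fun i => a ord0 i) k == i]%SET|.
  by apply: eq_card => k; rewrite !inE ffunE.
rewrite ler_norml => /andP [g1 g2]; rewrite ler_pdivlMr // ler_pdivrMr //.
rewrite !mulrDl -!mulrA mulVf ?gt_eqF //; apply/andP; split; lra.
Unshelve. all: by end_near.
Qed.

Lemma blowup_densityE (a : 'rV[R]_5) : simplex a ->
  blowup_density paw_blue (complete_graph 5) a = paw_poly (fun i => a ord0 i).
Proof.
move=> sa; have [p pa] := blowup_sequence sa.
have P : [set l : R | forall p, part_sizes_cvg a p ->
    density R paw_blue (blowup (complete_graph 5) (p n)) @[n --> \oo] --> l]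
    (paw_poly (fun i => a ord0 i)) by move=> q; exact: cvg_density_blowup.
have := getPex (ex_intro _ _ P) => /(_ p pa) lim.
exact: (cvg_unique _ lim (cvg_density_blowup pa)).
Qed.

End BlowupLimit.

(** * The limit density, perfect stability and the unique maximizer *)

Section Conclusion.
Variable R : realType.

Lemma paw_poly_uniform : paw_poly (fun _ : 'I_5 => 1 / 5 : R) = 12 / 125.
Proof.
have s5 (x : R) : \sum_(i < 5) x = 5 * x by rewrite !big_ord_recl big_ord0; ring.
by rewrite /paw_poly !s5; lra.
Qed.

Lemma simplex_uniform : simplex (const_mx (1 / 5) : 'rV[R]_5).
Proof.
split=> [i|]; first by rewrite mxE divr_ge0.
under eq_bigr do rewrite mxE.
by rewrite !big_ord_recl big_ord0; lra.
Qed.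

Lemma uniformE : (fun i => (const_mx (1 / 5) : 'rV[R]_5) ord0 i) = (fun=> 1 / 5).
Proof. by apply/funext => i; rewrite mxE. Qed.

(** Squeezed between the densities of balanced blowups of K_5 and the bound [embs_le] divided by the
    falling factorial. *)
Lemma max_density_cvg : max_density R paw_blue n @[n --> \oo] --> (12 / 125 : R).
Proof.
have [p pa] := blowup_sequence simplex_uniform.
have low := cvg_density_blowup pa.
have E : paw_poly (fun i => (const_mx (1 / 5) : 'rV[R]_5) ord0 i) = 12 / 125 :> R.
  by rewrite uniformE paw_poly_uniform.
rewrite E in low.
have up : (12 / 125 * (n%:R ^+ 4 / (n ^_ 4)%:R) : R) @[n --> \oo] --> (12 / 125 : R).
  rewrite -[X in _ --> X]mulr1; apply: cvgM; [exact: cvg_cst|exact: cvg_ffact4].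
apply: squeeze_cvgr low up; near=> n.
rewrite max_density_ge /=; apply: bigmax_le.
  by rewrite mulr_ge0 ?divr_ge0 ?exprn_ge0.
move=> G _; rewrite density_paw card_ord mulrA ler_wpM2r ?invr_ge0 //.
by have := embs_le R (@adj_sym _ G) (@adj_irr _ G); rewrite card_ord.
Unshelve. all: by end_near.
Qed.

Lemma paw_perfectly_stable : perfectly_stable R paw_blue (complete_graph 5).
Proof.
pose e : R := 1 / 100 ^+ 16; have e0 : 0 < e by rewrite divr_gt0 ?exprn_gt0.
have ev : \forall n \near \oo, 12 / 125 - e / 4 < max_density R paw_blue n
    /\ n%:R ^+ 4 / (n ^_ 4)%:R < 1 + e.
  near=> n; split; near: n.
    by apply: cvgr_gt max_density_cvg _ _; rewrite ltrBlDr ltrDl divr_gt0.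
  by apply: cvgr_lt (@cvg_ffact4 R) _ _; rewrite ltrDl.
have [N _ hN] := ev.
(* Beyond [N] the maximum and the falling factorials are close to their limits;
   [100 ^+ 17 * (e / 4) = 25] handles graphs far from extremal, and the constant of [embs_stability]
   is far smaller than [100 ^+ 17]. *)
pose C : R := 100 ^+ 17 + N%:R.
have C0 : 100 ^+ 17 <= C by rewrite lerDl.
have Cp : 0 < C by apply: lt_le_trans C0; rewrite exprn_gt0.
exists C; split=> // T G CT.
have nbig : 100 ^+ 13 <= #|T|%:R :> R.
  by apply: le_trans CT; apply: le_trans C0; rewrite ler_weXn2l //; lra.
have n0 : 0 < #|T|%:R :> R by apply: lt_le_trans nbig; rewrite exprn_gt0.
have NT : (N <= #|T|)%N by rewrite -(ler_nat R); apply: le_trans CT; rewrite lerDr exprn_ge0.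
have [md ff] := hN #|T| NT.
have T4 : (4 <= #|T|)%N.
  rewrite -(ler_nat R); apply: le_trans nbig; lra.
have f0 : 0 < (#|T| ^_ 4)%:R :> R by rewrite ltr0n ffact_gt0.
have n2 : 0 < #|T|%:R ^+ 2 :> R by rewrite exprn_gt0.
have n4 : 0 < #|T|%:R ^+ 4 :> R by rewrite exprn_gt0.
have [hbig|hsmall] := lerP ((12 / 125 - e) * #|T|%:R ^+ 4) (homs (adj G))%:R.
  have [p pE] := embs_stability (@adj_sym _ G) (@adj_irr _ G) nbig hbig.
  pose q : {ffun T -> 'I_5} := [ffun u => p u].
  have qE : blow p =2 blow q by move=> u v; rewrite /blow !ffunE.
  exists (blowup (complete_graph 5) q); split; first by exists q.
  apply: le_trans (_ : (disc (adj G) q)%:R <= _); first by rewrite ler_nat edit_dist_le.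
  have dE : disc (adj G) p = disc (adj G) q.
    by do 2 (apply: eq_bigr => ? _); rewrite qE.
  rewrite dE in pE; set d : R := (disc _ q)%:R in pE *.
  have d0 : 0 <= d by rewrite ler0n.
  have gap : (#|T|%:R ^+ 2 / 100 / 100 / 100 / 2 * d) / (#|T| ^_ 4)%:R <=
      max_density R paw_blue #|T| - density R paw_blue G.
    rewrite lerBrDr; apply: le_trans (max_density_ge_blow R p).
    rewrite density_paw -mulrDl ler_wpM2r ?invr_ge0 // addrC //.
  have gap2 : #|T|%:R ^+ 2 / 100 / 100 / 100 / 2 * d / #|T|%:R ^+ 4 <=
      max_density R paw_blue #|T| - density R paw_blue G.
    apply: le_trans gap; rewrite ler_wpM2l //.
      by rewrite mulr_ge0 // !divr_ge0 // ltW.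
    by rewrite lef_pV2 ?posrE // ffact4_le.
  rewrite -mulrA; apply: le_trans (_ : C * (d / 100 / 100 / 100 / 2) <= _).
    have : 100 ^+ 17 * d <= C * d by rewrite ler_wpM2r.
    lra.
  apply: ler_wpM2l; first exact: ltW.
  rewrite -ler_pdivrMr //; apply: le_trans gap2.
  rewrite le_eqVlt; apply/orP; left; apply/eqP; field; rewrite gt_eqF //.
(* Now the density of [G] is at least [e / 4] below the maximum, so any blowup will do: the edit
   distance never exceeds [n ^+ 2]. *)
pose q : {ffun T -> 'I_5} := [ffun=> ord0].
exists (blowup (complete_graph 5) q); split; first by exists q.
have d1 : (edit_dist G (blowup (complete_graph 5) q))%:R <= #|T|%:R ^+ 2 :> R.
  rewrite -natrX ler_nat; apply: leq_trans (edit_dist_le _ _) _.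
  rewrite -mulnn -sum_nat_const; apply: leq_sum => u _.
  by rewrite -[X in (_ <= X)%N]muln1 -sum_nat_const; apply: leq_sum => v _; apply: leq_b1.
apply: le_trans d1 _; rewrite -[leLHS]mul1r; apply: ler_wpM2r; first exact: ltW.
have dens : density R paw_blue G <= 12 / 125 - e / 2.
  rewrite density_paw; apply: le_trans (_ : (12 / 125 - e) * (#|T|%:R ^+ 4 / (#|T| ^_ 4)%:R) <= _).
    rewrite mulrA ler_wpM2r ?invr_ge0 //; apply: le_trans (ltW hsmall).
    by rewrite ler_nat (homs_embs (@adj_sym _ G) (@adj_irr _ G)) leq_addr.
  apply: le_trans (_ : (12 / 125 - e) * (1 + e) <= _).
    by rewrite ler_wpM2l ?(ltW ff) // /e; lra.
  have := sqr_ge0 e; lra.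
apply: ltW; apply: lt_le_trans (_ : 100 ^+ 17 * (e / 4) <= _).
  by rewrite /e; lra.
by apply: ler_pM => //; rewrite ?exprn_ge0 ?divr_ge0 ?(ltW e0) //; lra.
Unshelve. all: by end_near.
Qed.

(** At value 12/125 the quadratic term of [paw_poly_stability5] must vanish, which forces every
    weight to be 1/5. *)
Lemma paw_unique_maximizer (a : 'rV[R]_5) :
  is_maximizer paw_blue (complete_graph 5) a <-> a = const_mx (1 / 5).
Proof.
have U : blowup_density paw_blue (complete_graph 5) (const_mx (1 / 5) : 'rV[R]_5) = 12 / 125.
  by rewrite (blowup_densityE simplex_uniform) uniformE paw_poly_uniform.
split=> [[sa amax]|->].
  have := amax _ simplex_uniform; rewrite U (blowup_densityE sa) => large.
  case: sa => a0 a1.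
  have big : 12 / 125 - 1 / 2000 < paw_poly (fun i => a ord0 i) by lra.
  have stab := paw_poly_stability5 (card_ord 5) a0 a1 big.
  have sum0 : \sum_i (a ord0 i - 1 / 5) ^+ 2 <= 0 by lra.
  apply/rowP => i; rewrite mxE; apply/eqP; rewrite -subr_eq0 -sqrf_eq0 eq_le sqr_ge0 andbT.
  apply: le_trans sum0; rewrite (bigD1 i) //= lerDl.
  by apply: sumr_ge0 => j _; apply: sqr_ge0.
split; first exact: simplex_uniform.
move=> b sb; rewrite U (blowup_densityE sb); case: sb => b0 b1.
exact: paw_poly_le.
Qed.

End Conclusion.

Theorem theorem3p10 (R : realType) :
  [/\ max_density R paw_blue n @[n --> \oo] --> (12 / 125 : R),
      perfectly_stable R paw_blue (complete_graph 5)
    & forall a : 'rV[R]_5,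
        is_maximizer paw_blue (complete_graph 5) a <-> a = const_mx (1 / 5)].
Proof.
split; [exact: max_density_cvg|exact: paw_perfectly_stable|exact: paw_unique_maximizer].
Qed.
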